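(* Fix $d\ge2$ and, for $\rho\in(0,1]$, consider the sparse Rademacher prior $\mathcal X_{\mathrm{spRade}}(\rho)$. There exists a bound $\lambda^*_{\mathrm{spRade}(\rho),d}$ (a function of $\rho$) that behaves as $2\sqrt{-\rho\log\rho+O(\rho)}$ in the limit $\rho\to0$, such that: (1) if $\lambda<\lambda^*_{\mathrm{spRade}(\rho),d}$, then strong detection is impossible for $\mathrm{WT}(d,\lambda,\mathcal X_{\mathrm{spRade}}(\rho))$, and if moreover $d\ge3$, then weak detection and weak recovery are also impossible; (2) if $\lambda>2\sqrt{H(\rho)+\rho\log2}=2\sqrt{-\rho\log\rho+O(\rho)}$, then strong detection and weak recovery are possible for $\mathrm{WT}(d,\lambda,\mathcal X_{\mathrm{spRade}}(\rho))$. Here $H(\rho)=-\rho\log\rho-(1-\rho)\log(1-\rho)$.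
   Context: Wigner tensor: for integers $d\ge2$, $n\ge1$, $\mathrm{WT}(d)=\mathrm{WT}_n(d)$ is the law of the symmetric tensor $W\in(\mathbb R^n)^{\otimes d}$ obtained by drawing $W'\in\mathbb R^{n^d}$ with i.i.d. $\mathcal N(0,2/n)$ entries and averaging it over all $d!$ permutations of the indices. Inner products of tensors are entrywise. Spiked model: a prior $\mathcal X=\{\mathcal X_n\}$ is a family of distributions on unit vectors of $\mathbb R^n$. For $\lambda\ge0$ (not depending on $n$), $\mathrm{WT}(d,\lambda,\mathcal X)$ is the law of $T=\lambda x^{\otimes d}+W$ with $x\sim\mathcal X_n$ and $W\sim\mathrm{WT}_n(d)$ independent. Detection and recovery statements are in the limit $n\to\infty$ with $d,\lambda,\rho$ fixed. Sparse Rademacher prior $\mathcal X_{\mathrm{spRade}}(\rho)$: a support of exactly $\rho n$ of the $n$ coordinates is chosen uniformly at random, the entries of $x$ on the support are i.i.d. uniform on $\{\pm1/\sqrt{\rho n}\}$, and all other entries are $0$ ($n$ ranges over values for which $\rho n$ is an integer). Convention: $0\log0=0$; $\log$ is natural. Detection and recovery: one is given a single sample from either $\mathrm{WT}(d,\lambda,\mathcal X)$ or $\mathrm{WT}(d)$, each chosen with probability $1/2$. Strong detection: decide which one with success probability $1-o(1)$ as $n\to\infty$. Weak detection: decide with success probability at least $\frac12+\varepsilon$ as $n\to\infty$, for some $\varepsilon>0$ not depending on $n$. Weak recovery: given a sample $T$ from $\mathrm{WT}(d,\lambda,\mathcal X)$, output a unit vector $\hat x=\hat x(T)$ with $\mathbb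 E[\langle x,\hat x\rangle^d]\ge\varepsilon$ as $n\to\infty$, for some $\varepsilon>0$ not depending on $n$. These are information-theoretic notions; there is no computational restriction. *)

(* Defs.v *)
From HB Require Import structures.
From mathcomp Require Import all_boot all_order all_algebra perm.
From mathcomp Require Import all_classical all_reals all_analysis.
From mathcomp Require Import measurable_realfun.

Set Implicit Arguments.
Unset Strict Implicit.
Unset Printing Implicit Defensive.

Import Order.TTheory GRing.Theory Num.Theory.
Import numFieldNormedType.Exports.

Local Open Scope classical_set_scope.
Local Open Scope ring_scope.

Section iid.
Context d (T : measurableType d) (R : realType) (P : probability T R).

Definition tuple_cons n (p : T * n.-tuple T) : n.+1.-tuple T :=
  [tuple of p.1 :: p.2].

Lemma measurable_tuple_cons n : measurable_fun [set: _] (@tuple_cons n).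
Proof. exact: measurable_cons. Qed.

HB.instance Definition _ n := @isMeasurableFun.Build _ _ _ _ (@tuple_cons n)
  (@measurable_tuple_cons n).

(* the law of [n] i.i.d. draws from [P] *)
Fixpoint iid n : probability (n.-tuple T) R :=
  match n with
  | 0 => \d_[tuple]
  | m.+1 => distribution (P \x iid m)%E (@tuple_cons m)
  end.

End iid.

Section uniform_image.
Context d (T : measurableType d) (R : realType) (I : finType).
Variables (D : {set I}) (f : I -> T) (t0 : T).
Local Open Scope ereal_scope.

(* the law of [f i] for [i] uniform in [D]; the junk value [t0] is used only
   when [D] is empty *)
Definition uniform_image : set T -> \bar R := fun U =>
  if D == finset.set0 then \d_t0 U
  else (#|D|%:R^-1)%:E * \sum_(i in D) \d_(f i) U.

Let uniform_image0 : uniform_image set0 = 0.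
Proof.
rewrite /uniform_image; case: ifP => _; first exact: measure0.
by rewrite big1 ?mule0// => i _; rewrite measure0.
Qed.

Let uniform_image_ge0 U : 0 <= uniform_image U.
Proof.
rewrite /uniform_image; case: ifP => _; first exact: measure_ge0.
by apply: mule_ge0; [rewrite lee_fin invr_ge0|exact: sume_ge0].
Qed.

Let uniform_image_sigma_additive : semi_sigma_additive uniform_image.
Proof.
move=> F mF tF mUF; rewrite /uniform_image.
case: ifPn => D0; first exact: measure_semi_sigma_additive.
have [i0 i0D] : exists i0, i0 \in D by apply/set0Pn.
pose m k : {measure set T -> \bar R} := \d_(f (nth i0 (enum D) k)).
have sumE U : \sum_(i in D) \d_(f i) U = msum m #|D| U.
  rewrite /msum -big_enum/= (big_nth i0) big_mkord -cardE.
  by apply: eq_bigr.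
have c0 : (0 <= #|D|%:R^-1 :> R)%R by rewrite invr_ge0.
pose c := NngNum c0.
have E U : (#|D|%:R^-1)%:E * \sum_(i in D) \d_(f i) U
    = mscale c (msum m #|D|) U by rewrite sumE.
rewrite E; under eq_cvg do under eq_bigr do rewrite E.
exact: measure_semi_sigma_additive.
Qed.

HB.instance Definition _ := isMeasure.Build _ _ _ uniform_image
  uniform_image0 uniform_image_ge0 uniform_image_sigma_additive.

Let uniform_image_setT : uniform_image [set: T] = 1.
Proof.
rewrite /uniform_image; case: ifPn => D0; first by rewrite diracT.
under eq_bigr do rewrite diracT.
rewrite sumEFin -EFinM sumr_const mulVf//.
by rewrite pnatr_eq0 cards_eq0.
Qed.

HB.instance Definition _ := Measure_isProbability.Build _ _ _
  uniform_image uniform_image_setT.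

End uniform_image.

(* [normal_prob] lives on [measurableTypeR R]; this is the same measure on [R],
   whose measurable sets are the same but whose display differs. The parameter
   [sigma] is the standard deviation. *)
Section gaussian.
Context (R : realType) (sigma : R).

Definition gaussian : set R -> \bar R := normal_prob 0 sigma.

Let gaussian0 : gaussian set0 = 0%E.
Proof. exact: measure0. Qed.

Let gaussian_ge0 U : (0 <= gaussian U)%E.
Proof. exact: measure_ge0. Qed.

Let gaussian_sigma_additive : semi_sigma_additive gaussian.
Proof. exact: (@measure_semi_sigma_additive _ _ _ (normal_prob 0 sigma)). Qed.

HB.instance Definition _ := isMeasure.Build _ R R gaussian
  gaussian0 gaussian_ge0 gaussian_sigma_additive.

Let gaussian_setT : gaussian [set: R] = 1%E.
Proof. exact: (probability_setT (normal_prob 0 sigma)). Qed.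

HB.instance Definition _ := Measure_isProbability.Build _ _ _
  gaussian gaussian_setT.

End gaussian.

Section tensors.
Variable R : realType.

(* A tensor in (R^n)^{(x) d}, as the tuple of its entries; the entries are
   indexed by [d.-tuple 'I_n] and ranked by [enum_rank]. *)
Definition tensor d n := #|{: d.-tuple 'I_n}|.-tuple R.

Definition entry d n (t : tensor d n) (i : d.-tuple 'I_n) : R :=
  tnth t (enum_rank i).

Definition mktensor d n (f : d.-tuple 'I_n -> R) : tensor d n :=
  [tuple f (enum_val k) | k < #|{: d.-tuple 'I_n}|].

Lemma mktensorE d n (f : d.-tuple 'I_n -> R) i : entry (mktensor f) i = f i.
Proof. by rewrite /entry tnth_mktuple enum_rankK. Qed.

Definition rank1 d n (x : n.-tuple R) : tensor d n :=
  mktensor (fun i => \prod_(j < d) tnth x (tnth i j)).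

Definition symmetrize d n (w : tensor d n) : tensor d n :=
  mktensor (fun i =>
    (d`!%:R)^-1 * \sum_(s : 'S_d) entry w [tuple tnth i (s j) | j < d]).

Definition spike d n (lam : R) (p : n.-tuple R * tensor d n) : tensor d n :=
  mktensor (fun i => lam * entry (rank1 d p.1) i + entry p.2 i).

Definition dotp n (x y : n.-tuple R) : R := \sum_(i < n) tnth x i * tnth y i.

Lemma measurable_entry d n (i : d.-tuple 'I_n) :
  measurable_fun [set: tensor d n] (fun t => entry t i).
Proof. exact: measurable_tnth. Qed.

Lemma measurable_mktensor d' (T : measurableType d') d n
    (f : T -> d.-tuple 'I_n -> R) :
  (forall i, measurable_fun [set: T] (f ^~ i)) ->
  measurable_fun [set: T] (fun t => mktensor (f t)).
Proof.
move=> mf; apply/measurable_fun_tnthP => k.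
by apply: eq_measurable_fun (mf (enum_val k)) => t _ /=; rewrite tnth_mktuple.
Qed.

Lemma measurable_symmetrize d n :
  measurable_fun [set: tensor d n] (@symmetrize d n).
Proof.
apply: measurable_mktensor => i; apply: measurable_funM => //.
by apply: measurable_sum => s; exact: measurable_entry.
Qed.

Lemma measurable_spike d n lam :
  measurable_fun [set: n.-tuple R * tensor d n] (@spike d n lam).
Proof.
apply: measurable_mktensor => i; apply: measurable_funD.
  apply: measurable_funM => //.
  under eq_fun do rewrite mktensorE.
  apply: measurable_prod => j _.
  exact: measurableT_comp (measurable_tnth _) measurable_fst.
exact: measurableT_comp (measurable_entry _) measurable_snd.
Qed.

HB.instance Definition _ d n := @isMeasurableFun.Build _ _ _ _
  (@symmetrize d n) (@measurable_symmetrize d n).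
HB.instance Definition _ d n lam := @isMeasurableFun.Build _ _ _ _
  (@spike d n lam) (@measurable_spike d n lam).

Definition WT d n : probability (tensor d n) R :=
  distribution (iid (gaussian (Num.sqrt (2 / n%:R))) #|{: d.-tuple 'I_n}|
                : probability (tensor d n) R)
    (@symmetrize d n).

Definition prior := forall n, probability (n.-tuple R) R.

(* the joint law of the independent pair [(x, W)] *)
Definition spike_noise d n (X : prior) :
  probability (n.-tuple R * tensor d n)%type R := (X n \x WT d n)%E.

Definition spikedWT d n (lam : R) (X : prior) : probability (tensor d n) R :=
  distribution (spike_noise d n X) (@spike d n lam).

(* The decision rule answers [true] for the spiked law. *)
Definition success d n lam (X : prior) (phi : tensor d n -> bool) : \bar R :=
  (2^-1%:E * spikedWT d n lam X [set t | phi t]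
   + 2^-1%:E * WT d n [set t | ~~ phi t])%E.

(* The limit n -> oo is a filter [F] on [nat], so that it can be restricted to
   the dimensions for which a prior is defined. *)
Definition strong_detection (F : set_system nat) d lam (X : prior) :=
  exists phi : forall n, {mfun tensor d n >-> bool},
    success lam X (phi n) @[n --> F] --> 1%E.

Definition weak_detection (F : set_system nat) d lam (X : prior) :=
  exists (phi : forall n, {mfun tensor d n >-> bool}) (eps : R),
    0 < eps /\
    \forall n \near F, ((2^-1 + eps)%:E <= success lam X (phi n))%E.

(* There is no unit vector for n = 0. *)
Definition weak_recovery (F : set_system nat) d lam (X : prior) :=
  exists (xhat : forall n, {mfun tensor d n >-> n.-tuple R}) (eps : R),
    [/\ forall n t, (0 < n)%N -> Num.sqrt (dotp (xhat n t) (xhat n t)) = 1,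
        0 < eps &
        \forall n \near F, (eps%:E <= 'E_(spike_noise d n X)
          [fun p => (dotp p.1 (xhat n (spike lam p)) ^+ d)%R])%E].

(* A sample is given by its support [p.1] and by signs [p.2] (the signs off the
   support are ignored). *)
Definition sprade_vector (rho : R) n (p : {set 'I_n} * {ffun 'I_n -> bool}) :
    n.-tuple R :=
  [tuple if i \in p.1 then (-1) ^+ p.2 i / Num.sqrt (rho * n%:R) else 0
   | i < n].

Definition sprade (rho : R) : prior := fun n =>
  uniform_image R
    [set p : {set 'I_n} * {ffun 'I_n -> bool} | #|p.1|%:R == rho * n%:R]%SET
    (@sprade_vector rho n) [tuple 0 | i < n].

Definition sprade_dim (rho : R) : set nat :=
  [set n | (0 < n)%N /\ rho * n%:R \is a Num.nat].

Definition sprade_oo (rho : R) : set_system nat := within (sprade_dim rho) \oo.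

(* [ln 0 = 0], so that 0 log 0 = 0. *)
Definition entropy (rho : R) : R :=
  - rho * ln rho - (1 - rho) * ln (1 - rho).

(* f(rho) = 2 sqrt (- rho log rho + O(rho)) as rho -> 0+ *)
Definition sqrt_rho_log_rho_asymp (f : R -> R) :=
  exists2 r : R -> R, r =O_ (0^'+) (@id R) &
    \forall rho \near 0^'+, f rho = 2 * Num.sqrt (- rho * ln rho + r rho).

End tensors.

(* Main.v *)
(** Both laws are pulled back to the i.i.d. noise [w] before symmetrization, which
    fixes rank-one tensors and preserves inner products with them.  There the
    spiked law has density [avg_x L_x] with
    [L_x = exp (n lam <x^d, w> / 2 - n lam^2 / 4)], by Cameron-Martin.

    Impossibility.  [L_x] is truncated to [<x^d, w> <= lam + del], which is typical
    under the spiked law.  In the second moment of the truncated mixture, a pair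
    with [s = <x, x'>^d >= 0] contributes [exp (n lam^2 / 2 * s / (1 + s))] up to
    [del], against [exp (n lam^2 / 2 * s)] without truncation: at [s = 1] this
    gains the factor [sqrt 2] on [lam].  If [lam^2 < 4 rho beta] with
    [beta = - ln rho - C], the contribution of an overlap [t] is at most
    [exp (2 k beta t^2 / (1 + t^2))], where [k = rho n].  If the supports share
    [j > k / (96 beta)] indices, it is beaten by the probability
    ['C(k, j) rho^j] of this event because [2 t^2 / (1 + t^2) <= |t|]; otherwise
    the overlap is a subgaussian sum of [j] signs and the expectation stays
    bounded.  When [d >= 3] the second moment even tends to [1], so the two laws
    merge, and the second moment weighted by [s] tends to [0]; by Cauchy-Schwarz
    the latter bounds [E <x, xhat>^d] for every estimator.

    Possibility.  A union bound over the ['C(n, k) 2^k <= exp (n (H + rho ln 2))]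
    possible spikes shows that pure noise has no score above a threshold
    which the score of the true spike exceeds. *)

(* Without truncation, identical spikes alone would limit the argument to
   [lam ^+ 2 < - 2 rho ln rho]; the truncation is what makes the leading terms of the two thresholds
   agree. Only that leading term has to be sharp: every other constant is wasteful and ends up in
   the [O(rho)] term through [lower_constant].

   The delicate pairs are those whose supports share a fraction [tau] of their indices. At [tau = 1]
   the exponent [2 beta tau / (1 + tau^2)] per shared index equals the cost [beta] of sharing it, so
   nothing is left there to pay for the entropy factor [1 / tau], but this factor is then bounded.
   For small [tau] the slack is proportional to [beta], while [1 / tau] is large; the cutoff
   [j > k / (96 beta)] keeps [1 / tau] below [96 beta], which an exponential in [beta] beats.

   Cauchy-Schwarz is always used pointwise, in its AM-GM form with a free parameter [eta], so that
   only integrals of nonnegative functions occur. *)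
Require Import Defs.
From HB Require Import structures.
From mathcomp Require Import all_boot all_order all_algebra.
From mathcomp Require Import all_classical all_reals all_analysis.
From mathcomp Require Import perm measurable_realfun ring lra.
Set Implicit Arguments.
Unset Strict Implicit.
Unset Printing Implicit Defensive.
Import Order.TTheory GRing.Theory Num.Theory.
Import numFieldNormedType.Exports.
Local Open Scope classical_set_scope.
Local Open Scope ring_scope.

(** * Gaussian vectors *)

Section density.
Local Open Scope ereal_scope.
Import HBNNSimple.
Context d (T : measurableType d) (R : realType).
Variables (mu nu : {measure set T -> \bar R}) (g : T -> R).
Hypotheses (g0 : forall x, (0 <= g x)%R) (mg : measurable_fun [set: T] g).
Hypothesis nuE : forall A, measurable A -> nu A = \int[mu]_(x in A) (g x)%:E.

Lemma ge0_integral_density (f : T -> \bar R) :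
  measurable_fun [set: T] f -> (forall x, 0 <= f x) ->
  \int[nu]_x f x = \int[mu]_x (f x * (g x)%:E).
Proof.
move=> mf f0; pose h := nnsfun_approx measurableT mf.
have mgE : measurable_fun [set: T] (EFin \o g) by exact/measurable_EFinP.
have -> : \int[nu]_x f x = limn (fun n => \int[nu]_x (h n x)%:E).
  rewrite -monotone_convergence//.
  - apply: eq_integral => x _; apply/esym/cvg_lim => //.
    by apply: cvg_nnsfun_approx.
  - by move=> n; exact/measurable_EFinP/measurable_funP.
  - by move=> n x _; rewrite lee_fin.
  - by move=> x _ a b ab; rewrite lee_fin; exact/lefP/nd_nnsfun_approx.
have -> : \int[mu]_x (f x * (g x)%:E) =
    limn (fun n => \int[mu]_x ((h n x)%:E * (g x)%:E)).
  rewrite -monotone_convergence//.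
  - apply: eq_integral => x _; apply/esym/cvg_lim => //.
    by apply: cvgeZr => //; exact: cvg_nnsfun_approx.
  - move=> n; apply: emeasurable_funM => //.
    exact/measurable_EFinP/measurable_funP.
  - by move=> n x _; rewrite mule_ge0 ?lee_fin.
  - move=> x _ a b ab; rewrite lee_wpmul2r ?lee_fin//.
    exact/lefP/nd_nnsfun_approx.
congr (limn _); apply/funext => n.
transitivity (\sum_(k \in range (h n)) k%:E * nu (h n @^-1` [set k])).
  by rewrite integralT_nnsfun sintegralE.
transitivity (\int[mu]_x (\sum_(k \in range (h n))
   (k * \1_(h n @^-1` [set k]) x * g x)%:E)); last first.
  apply: eq_integral => x _; rewrite -EFinM [in RHS]fimfunE fsumEFin//.
  by rewrite fsbig_finite//= fsbig_finite//= big_distrl.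
rewrite ge0_integral_fsum//=; last 2 first.
- move=> k; apply/measurable_EFinP; apply: measurable_funM => //.
  exact: measurable_funM.
- move=> k x _; rewrite lee_fin mulr_ge0//.
  by have := nnfun_muleindic_ge0 (h n) k x; rewrite lee_fin.
apply: eq_fsbigr => k /[!inE] -[y _ <-{k}].
transitivity ((h n y)%:E * \int[mu]_x ((\1_(h n @^-1` [set h n y]) x * g x)%:E)).
  congr (_ * _); rewrite nuE// integral_mkcond.
  apply: eq_integral => x _; rewrite patchE indicE.
  by case: ifPn => _; rewrite ?mul1r ?mul0r.
rewrite -ge0_integralZl//=.
- by apply: eq_integral => x _; rewrite -EFinM mulrA.
- by apply/measurable_EFinP/measurable_funM.
- by move=> x _; rewrite lee_fin mulr_ge0.
- by rewrite lee_fin.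
Qed.

End density.

Section shift.
Context {R : realType}.
Local Notation mu := (@lebesgue_measure R).

(** The pushforward still gives each interval []a, b]] its length, and Lebesgue measure is unique
    with this property. *)
Lemma lebesgue_measure_shift (h : R) (A : set (measurableTypeR R)) :
  measurable A ->
  pushforward mu (fun x : measurableTypeR R => (x + h : measurableTypeR R)) A
  = mu A.
Proof.
move=> mA.
have mh : measurable_fun [set: measurableTypeR R]
   (fun x : measurableTypeR R => (x + h : measurableTypeR R)).
  exact: (@measurable_funD _ (measurableTypeR R) R setT (fun x => x) (cst h)).
apply/esym/lebesgue_measure_unique => //= _ [[a b]] _ <-.
rewrite /pushforward.
have -> : (fun x : R => x + h) @^-1` `]a, b]%classic = `]a - h, b - h]%classic.
  by apply/seteqP; split=> x /=; rewrite !in_itv/= ltrBlDr lerBrDr.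
rewrite !lebesgue_measure_itv/= !lte_fin ltrD2r.
by case: ifP => // _; rewrite -!EFinD; congr (_%:E); ring.
Qed.

Lemma ge0_integral_shift (h : R) (f : R -> \bar R) :
  measurable_fun [set: R] f -> (forall x, 0 <= f x)%E ->
  (\int[mu]_x f (x + h)%R = \int[mu]_x f x)%E.
Proof.
move=> mf f0.
have mh : measurable_fun [set: measurableTypeR R]
   (fun x : measurableTypeR R => (x + h : measurableTypeR R)).
  exact: (@measurable_funD _ (measurableTypeR R) R setT (fun x => x) (cst h)).
pose sh := fun x : measurableTypeR R => (x + h : measurableTypeR R).
transitivity (\int[pushforward mu sh]_x f x)%E.
  by rewrite ge0_integral_pushforward.
by apply: eq_measure_integral => A mA _; exact: lebesgue_measure_shift.
Qed.
End shift.

Section gaussian_integral.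
Context {R : realType}.
Local Notation mu := (@lebesgue_measure R).

Lemma ge0_integral_gaussian (sigma : R) (f : R -> \bar R) :
  measurable_fun [set: R] f -> (forall x, 0 <= f x)%E ->
  (\int[gaussian sigma]_x f x =
   \int[mu]_x (f x * (normal_pdf 0 sigma x)%:E))%E.
Proof.
move=> mf f0.
rewrite -(@ge0_integral_density _ _ _ _ (normal_prob 0 sigma))//; last 2 first.
- exact: normal_pdf_ge0.
- exact: measurable_normal_pdf.
(* [gaussian] and [normal_prob] are one set function on two displays; the pushforward along the
   identity passes from one to the other. *)
pose i := fun x : R => (x : measurableTypeR R).
have mi : measurable_fun [set: R] i by move=> _ A mA; rewrite setTI.
transitivity (\int[pushforward (gaussian sigma) i]_x f x)%E => //.
by rewrite ge0_integral_pushforward.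
Qed.

(** Cameron-Martin in dimension one: translating the Lebesgue integral moves the shift into the
    density, and the exponential is the ratio of the densities at [x - h] and [x]. *)
Lemma ge0_integral_gaussian_shift (sigma h : R) (f : R -> \bar R) :
  sigma != 0 -> measurable_fun [set: R] f -> (forall x, 0 <= f x)%E ->
  (\int[gaussian sigma]_x f (x + h)%R = \int[gaussian sigma]_x
    (f x * (expR (h * x / sigma ^+ 2 - h ^+ 2 / (2 * sigma ^+ 2)))%:E))%E.
Proof.
move=> s0 mf f0.
have mfh : measurable_fun [set: R] (fun x => f (x + h)).
  by apply: measurableT_comp => //; exact: measurable_funD.
have me : measurable_fun [set: R]
    (fun x => expR (h * x / sigma ^+ 2 - h ^+ 2 / (2 * sigma ^+ 2))).
  apply: measurableT_comp => //; apply: measurable_funB => //.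
  by apply: measurable_funM => //; exact: measurable_funM.
rewrite ge0_integral_gaussian// ge0_integral_gaussian//; last 2 first.
- by apply: emeasurable_funM => //; exact/measurable_EFinP.
- by move=> x; rewrite mule_ge0// lee_fin expR_ge0.
pose F x := (f x * (normal_pdf 0 sigma (x - h))%:E)%E.
have mF : measurable_fun [set: R] F.
  apply: emeasurable_funM => //; apply/measurable_EFinP.
  apply: (measurableT_comp (measurable_normal_pdf 0 sigma)).
  exact: measurable_funB.
have F0 x : (0 <= F x)%E by rewrite mule_ge0// lee_fin normal_pdf_ge0.
transitivity (\int[mu]_x F (x + h)%R)%E.
  by apply: eq_integral => x _; rewrite /F addrK.
rewrite ge0_integral_shift//; apply: eq_integral => x _.
rewrite /F -muleA -EFinM normal_pdfE//; congr (_ * _%:E)%E.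
rewrite mulrCA; congr (_ * _).
rewrite /normal_fun -expRD; congr expR.
by rewrite !subr0 -mulr_natl; field.
Qed.
End gaussian_integral.

Section tuples.
Variable R : realType.

Definition addt n (x y : n.-tuple R) : n.-tuple R :=
  [tuple tnth x i + tnth y i | i < n].

Lemma tnth_addt n (x y : n.-tuple R) i :
  tnth (addt x y) i = tnth x i + tnth y i.
Proof. by rewrite tnth_mktuple. Qed.

Lemma dotpC n (x y : n.-tuple R) : dotp x y = dotp y x.
Proof. by apply: eq_bigr => i _; rewrite mulrC. Qed.

Lemma dotpDr n (x y z : n.-tuple R) : dotp x (addt y z) = dotp x y + dotp x z.
Proof.
by rewrite /dotp -big_split/=; apply: eq_bigr => i _; rewrite tnth_addt mulrDr.
Qed.

Lemma measurable_dotp n (x : n.-tuple R) :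
  measurable_fun [set: n.-tuple R] (dotp x).
Proof.
apply: measurable_sum => i; apply: measurable_funM => //.
exact: measurable_tnth.
Qed.

Lemma measurable_addt n (x : n.-tuple R) :
  measurable_fun [set: n.-tuple R] (fun y => addt y x).
Proof.
apply/measurable_fun_tnthP => i.
apply: (@eq_measurable_fun _ _ _ _ _ (fun y : n.-tuple R => tnth y i + tnth x i)).
  by move=> y _ /=; rewrite tnth_addt.
by apply: measurable_funD => //; exact: measurable_tnth.
Qed.

End tuples.

Section iid_gaussian.
Variables (R : realType) (sigma : R).
Hypothesis s0 : sigma != 0.
Local Notation G := (iid (gaussian sigma)).

(** The Cameron-Martin density of the law of [addt w h] with respect to that of [w]. *)
Definition tilt n (h w : n.-tuple R) : R :=
  expR (dotp h w / sigma ^+ 2 - dotp h h / (2 * sigma ^+ 2)).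

Lemma tilt_ge0 n (h w : n.-tuple R) : 0 <= tilt h w.
Proof. exact: expR_ge0. Qed.

Lemma measurable_tilt n (h : n.-tuple R) :
  measurable_fun [set: n.-tuple R] (tilt h).
Proof.
apply: measurableT_comp => //; apply: measurable_funB => //.
by apply: measurable_funM => //; exact: measurable_dotp.
Qed.

Lemma ge0_integral_iidS n (f : n.+1.-tuple R -> \bar R) :
  measurable_fun [set: n.+1.-tuple R] f -> (forall x, 0 <= f x)%E ->
  (\int[G n.+1]_w f w =
   \int[gaussian sigma]_x \int[G n]_w f (tuple_cons (x, w)))%E.
Proof.
move=> mf f0.
rewrite /= ge0_integral_distribution//=.
rewrite fubini_tonelli1//.
by apply: measurableT_comp => //; exact: measurable_tuple_cons.
Qed.

Local Opaque iid.

Lemma tnth_tuple_cons0 n (x : R) (w : n.-tuple R) :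
  tnth (tuple_cons (x, w)) ord0 = x.
Proof. by []. Qed.

Lemma tnth_tuple_consS n (x : R) (w : n.-tuple R) i :
  tnth (tuple_cons (x, w)) (lift ord0 i) = tnth w i.
Proof. by rewrite /tuple_cons/= tnthS. Qed.

Lemma tuple_consE n (h : n.+1.-tuple R) :
  exists x w, h = tuple_cons (x, w).
Proof.
exists (thead h), (behead_tuple h); apply: val_inj => /=.
by rewrite /thead; case: h => -[|a l] //= ?; rewrite tnth0.
Qed.

Lemma dotp_tuple_cons n (x y : R) (v w : n.-tuple R) :
  dotp (tuple_cons (x, v)) (tuple_cons (y, w)) = x * y + dotp v w.
Proof.
rewrite /dotp big_ord_recl !tnth_tuple_cons0; congr (_ + _).
by apply: eq_bigr => i _; rewrite !tnth_tuple_consS.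
Qed.

Lemma addt_tuple_cons n (x y : R) (v w : n.-tuple R) :
  addt (tuple_cons (x, v)) (tuple_cons (y, w)) =
  tuple_cons (x + y, addt v w).
Proof.
apply: eq_from_tnth => i; rewrite tnth_addt.
by case: (unliftP ord0 i) => [j|] ->;
  rewrite ?tnth_tuple_consS ?tnth_addt// !tnth_tuple_cons0.
Qed.

(** The density factorises over the coordinates: Tonelli isolates the first one, the induction
    hypothesis shifts the others for each value of it, and the one-dimensional formula shifts the
    first. *)
Lemma ge0_integral_iid_shift n (h : n.-tuple R) (f : n.-tuple R -> \bar R) :
  measurable_fun [set: n.-tuple R] f -> (forall x, 0 <= f x)%E ->
  (\int[G n]_w f (addt w h) = \int[G n]_w (f w * (tilt h w)%:E))%E.
Proof.
elim: n => [|n IH] in h f *.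
  move=> mf f0; apply: eq_integral => w _.
  rewrite (tuple0 w) (tuple0 (addt _ _)) /tilt /dotp !big_ord0 !mul0r subrr.
  by rewrite expR0 mule1.
move=> mf f0.
have mfh : measurable_fun [set: n.+1.-tuple R] (fun w => f (addt w h)).
  by apply: measurableT_comp => //; exact: measurable_addt.
have mft (k : nat) (g : k.-tuple R -> \bar R) (v : k.-tuple R) :
    measurable_fun [set: k.-tuple R] g ->
    measurable_fun [set: k.-tuple R] (fun w => g w * (tilt v w)%:E)%E.
  move=> mg; apply: emeasurable_funM => //.
  by apply/measurable_EFinP; exact: measurable_tilt.
rewrite ge0_integral_iidS// ge0_integral_iidS//; last 2 first.
- exact: mft.
- by move=> x; rewrite mule_ge0// lee_fin tilt_ge0.
have [a [v ->]] := tuple_consE h.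
have mcons x : measurable_fun [set: n.-tuple R] (fun w => tuple_cons (x, w)).
  by apply: measurableT_comp => //; exact: measurable_tuple_cons.
pose F (x : R) : \bar R :=
  (\int[G n]_w (f (tuple_cons (x, w)) * (tilt v w)%:E))%E.
have mFF : measurable_fun [set: R * n.-tuple R]
    (fun p => f (tuple_cons p) * (tilt v p.2)%:E)%E.
  apply: emeasurable_funM.
    by apply: measurableT_comp => //; exact: measurable_tuple_cons.
  apply/measurable_EFinP; apply: measurableT_comp => //.
  exact: measurable_tilt.
transitivity (\int[gaussian sigma]_x F (x + a)%R)%E.
  apply: eq_integral => x _; rewrite /F.
  rewrite -(IH v (fun w => f (tuple_cons (x + a, w))))//.
    by apply: eq_integral => w _; rewrite addt_tuple_cons.
  exact: measurableT_comp.
rewrite (ge0_integral_gaussian_shift a (f := F))//; last 2 first.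
- apply: (measurable_fun_fubini_tonelli_F (m2 := G n)
    (fun p => f (tuple_cons p) * (tilt v p.2)%:E)%E) => // p.
  by rewrite mule_ge0// lee_fin tilt_ge0.
- by move=> x; apply: integral_ge0 => w _; rewrite mule_ge0// lee_fin tilt_ge0.
apply: eq_integral => x _; rewrite /F -ge0_integralZr//; last 2 first.
- by apply: (mft n (fun w => f (tuple_cons (x, w)))); exact: measurableT_comp.
- by move=> w _; rewrite mule_ge0// lee_fin tilt_ge0.
apply: eq_integral => w _; rewrite -muleA -EFinM; congr (_ * _%:E)%E.
rewrite /tilt !dotp_tuple_cons -expRD; congr expR.
by field.
Qed.

End iid_gaussian.

Section nonnegative_integral.
Context d (T : measurableType d) (R : realType).
Variable mu : {measure set T -> \bar R}.
Implicit Types f g : T -> R.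

(** For nonnegative real integrands, linearity and monotonicity hold without integrability; the
    second moment is computed entirely in this form. *)
Lemma integral_EFinZl (c : R) f : measurable_fun [set: T] f ->
  (forall x, 0 <= f x) -> 0 <= c ->
  (\int[mu]_x (c * f x)%:E = c%:E * \int[mu]_x (f x)%:E)%E.
Proof.
move=> mf f0 c0; under eq_integral do rewrite EFinM.
apply: ge0_integralZl => //; first exact/measurable_EFinP.
by move=> x _; rewrite lee_fin.
Qed.

Lemma integral_EFinD f g : measurable_fun [set: T] f ->
  measurable_fun [set: T] g -> (forall x, 0 <= f x) -> (forall x, 0 <= g x) ->
  (\int[mu]_x (f x + g x)%:E = \int[mu]_x (f x)%:E + \int[mu]_x (g x)%:E)%E.
Proof.
move=> mf mg f0 g0; under eq_integral do rewrite EFinD.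
apply: ge0_integralD => //.
- by move=> x _; rewrite lee_fin.
- exact/measurable_EFinP.
- by move=> x _; rewrite lee_fin.
- exact/measurable_EFinP.
Qed.

Lemma integral_EFin_sum (I : Type) (r : seq I) (P : pred I) (f : I -> T -> R) :
  (forall i, measurable_fun [set: T] (f i)) -> (forall i x, 0 <= f i x) ->
  (\int[mu]_x (\sum_(i <- r | P i) f i x)%:E =
   \sum_(i <- r | P i) \int[mu]_x (f i x)%:E)%E.
Proof.
move=> mf f0.
have m1 s : measurable_fun [set: T] (fun x => \sum_(i <- s | P i) f i x).
  rewrite (_ : (fun _ => _) = (fun x => \sum_(i <- [seq j <- s | P j]) f i x)).
    exact: measurable_sum.
  by apply/funext => x; rewrite big_filter.
elim: r => [|i r IH].
  by under eq_integral do rewrite big_nil; rewrite integral0 big_nil.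
rewrite big_cons -IH; case: ifPn => Pi; last first.
  by apply: eq_integral => x _; rewrite big_cons (negbTE Pi).
rewrite -integral_EFinD//.
  by apply: eq_integral => x _; rewrite big_cons Pi.
by move=> x; apply: sumr_ge0.
Qed.

Lemma le_integral_EFin f g : measurable_fun [set: T] f ->
  measurable_fun [set: T] g -> (forall x, 0 <= f x) -> (forall x, f x <= g x) ->
  (\int[mu]_x (f x)%:E <= \int[mu]_x (g x)%:E)%E.
Proof.
move=> mf mg f0 fg; apply: ge0_le_integral => //.
- by move=> x _; rewrite lee_fin.
- exact/measurable_EFinP.
- exact/measurable_EFinP.
- by move=> x _; rewrite lee_fin.
Qed.

End nonnegative_integral.

Section gaussian_moments.
Variables (R : realType) (sigma : R).
Hypothesis s0 : sigma != 0.
Local Notation G := (iid (gaussian sigma)).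
Local Opaque iid.
(** The tilted law has total mass 1, and for the shift [sigma ^+ 2 * h] the tilt is a constant times
    [expR (dotp h w)]. *)
Lemma integral_iid_expR n (h : n.-tuple R) :
  (\int[G n]_w (expR (dotp h w))%:E = (expR (sigma ^+ 2 * dotp h h / 2))%:E)%E.
Proof.
pose v : n.-tuple R := [tuple sigma ^+ 2 * tnth h i | i < n].
have vE w : dotp v w = sigma ^+ 2 * dotp h w.
  rewrite /dotp big_distrr/=; apply: eq_bigr => i _.
  by rewrite tnth_mktuple mulrA.
have := ge0_integral_iid_shift s0 v (f := cst 1%E) (measurable_cst _) (fun=> lee01).
rewrite integral_cst//= probability_setT mule1 => /esym.
under eq_integral do rewrite mul1e.
pose c := expR (- (sigma ^+ 2 * dotp h h / 2)).
rewrite (eq_integral (fun w => (c * expR (dotp h w))%:E)%E); last first.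
  move=> w _; rewrite /c /tilt -expRD; congr (expR _)%:E.
  by rewrite vE dotpC vE [dotp h v]dotpC vE; field.
rewrite integral_EFinZl ?expR_ge0//; last first.
  by apply: measurableT_comp => //; exact: measurable_dotp.
move=> /(congr1 (fun z => (expR (sigma ^+ 2 * dotp h h / 2))%:E * z)%E).
by rewrite muleA -EFinM -expRD subrr expR0 mul1e mule1.
Qed.

Lemma iid_dotp_tail n (h : n.-tuple R) (t : R) : 0 <= t -> dotp h h = 1 ->
  (G n [set w | (t <= dotp h w)%R] <= (expR (- (t ^+ 2 / (2 * sigma ^+ 2))))%:E)%E.
Proof.
move=> t0 h1.
have mA : measurable [set w : n.-tuple R | t <= dotp h w].
  rewrite -[X in measurable X]setTI.
  by apply: measurable_fun_le => //; exact: measurable_dotp.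
(* The minimiser of the Chernoff exponent [- a t + sigma^2 a^2 / 2]. *)
pose a := t / sigma ^+ 2.
have s2 : 0 < sigma ^+ 2 by rewrite lt0r sqrf_eq0 s0 sqr_ge0.
have a0 : 0 <= a by rewrite divr_ge0// ltW.
pose v : n.-tuple R := [tuple a * tnth h i | i < n].
have vE w : dotp v w = a * dotp h w.
  rewrite /dotp big_distrr/=; apply: eq_bigr => i _.
  by rewrite tnth_mktuple mulrA.
rewrite -[X in (G n X <= _)%E]setIT -integral_indic//.
have me : measurable_fun [set: n.-tuple R] (fun w => expR (dotp v w)).
  by apply: measurableT_comp => //; exact: measurable_dotp.
apply: (@le_trans _ _ (\int[G n]_w (expR (- (a * t)) * expR (dotp v w))%:E)%E).
  apply: le_integral_EFin => //.
  - exact: measurable_funM.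
  - move=> w; rewrite -expRD vE indicE.
    case: (boolP (w \in _)) => [|_]; last exact: expR_ge0.
    rewrite inE/= => tw; rewrite -[leLHS]expR0 ler_expR addrC subr_ge0.
    by rewrite ler_wpM2l.
rewrite integral_EFinZl ?expR_ge0//.
rewrite integral_iid_expR -EFinM lee_fin -expRD ler_expR vE dotpC vE h1.
rewrite le_eqVlt; apply/orP; left; apply/eqP; rewrite /a; field.
by rewrite s0.
Qed.

End gaussian_moments.

(** * Tensors and the uniform prior *)

Section tensor_algebra.
Variable R : realType.

Definition scalet n (a : R) (x : n.-tuple R) : n.-tuple R :=
  [tuple a * tnth x i | i < n].

Lemma dotpZl n (a : R) (x y : n.-tuple R) : dotp (scalet a x) y = a * dotp x y.
Proof.
by rewrite /dotp big_distrr/=; apply: eq_bigr => i _; rewrite tnth_mktuple mulrA.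
Qed.

Lemma dotpZr n (a : R) (x y : n.-tuple R) : dotp x (scalet a y) = a * dotp x y.
Proof. by rewrite dotpC dotpZl dotpC. Qed.

Lemma dotpDl n (x y z : n.-tuple R) : dotp (addt x y) z = dotp x z + dotp y z.
Proof. by rewrite dotpC dotpDr !(dotpC z). Qed.

Lemma dotp_entry d n (x y : tensor R d n) :
  dotp x y = \sum_(i : d.-tuple 'I_n) entry x i * entry y i.
Proof.
rewrite /dotp (reindex (@enum_rank _)) /=; last first.
  by exists (@enum_val _ _) => i _; rewrite ?enum_rankK ?enum_valK.
by apply: eq_bigl.
Qed.

Lemma entry_addt d n (x y : tensor R d n) i :
  entry (addt x y : tensor R d n) i = entry x i + entry y i.
Proof. exact: tnth_addt. Qed.

Lemma entry_scalet d n a (x : tensor R d n) i :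
  entry (scalet a x : tensor R d n) i = a * entry x i.
Proof. by rewrite /entry tnth_mktuple. Qed.

Lemma eq_from_entry d n (x y : tensor R d n) :
  (forall i, entry x i = entry y i) -> x = y.
Proof.
move=> xy; apply: eq_from_tnth => i; have := xy (enum_val i).
by rewrite /entry enum_valK.
Qed.

Lemma dotp_rank1 d n (x y : n.-tuple R) :
  dotp (rank1 d x) (rank1 d y) = dotp x y ^+ d.
Proof.
rewrite dotp_entry -[d in RHS]card_ord -prodr_const /dotp bigA_distr_bigA/=.
rewrite (reindex (fun f : {ffun 'I_d -> 'I_n} => [tuple f j | j < d]))/=.
  apply: eq_bigr => f _; rewrite !mktensorE -big_split/=.
  by apply: eq_bigr => j _; rewrite !tnth_mktuple.
exists (fun t => [ffun j => tnth t j]) => [f _|t _].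
  by apply/ffunP => j; rewrite ffunE tnth_mktuple.
by apply: eq_from_tnth => j; rewrite tnth_mktuple ffunE.
Qed.

Definition perm_index d n (s : 'S_d) (i : d.-tuple 'I_n) : d.-tuple 'I_n :=
  [tuple tnth i (s j) | j < d].

Lemma perm_index_bij d n (s : 'S_d) : bijective (@perm_index d n s).
Proof.
exists (@perm_index d n s^-1%g) => i; apply: eq_from_tnth => j;
  by rewrite !tnth_mktuple ?permK ?permKV.
Qed.

Lemma entry_rank1_perm d n (x : n.-tuple R) s (i : d.-tuple 'I_n) :
  entry (rank1 d x) (perm_index s i) = entry (rank1 d x) i.
Proof.
rewrite !mktensorE [RHS](reindex_inj (@perm_inj _ s)).
by apply: eq_bigr => j _; rewrite tnth_mktuple.
Qed.

(** Each index permutation can be moved from [w] to the rank-one tensor, which it leaves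
    unchanged. *)
Lemma dotp_rank1_symmetrize d n (x : n.-tuple R) (w : tensor R d n) :
  dotp (rank1 d x) (symmetrize w) = dotp (rank1 d x) w.
Proof.
rewrite dotp_entry.
transitivity (\sum_(i : d.-tuple 'I_n) \sum_(s : 'S_d)
   d`!%:R^-1 * (entry (rank1 d x) i * entry w (perm_index s i))).
  apply: eq_bigr => i _; rewrite [X in _ * X]mktensorE mulrCA -big_distrr/=.
  by rewrite big_distrr.
rewrite exchange_big/=.
transitivity (\sum_(s : 'S_d) d`!%:R^-1 * dotp (rank1 d x) w).
  apply: eq_bigr => s _; rewrite -big_distrr/=; congr (_ * _).
  rewrite dotp_entry [RHS](reindex (perm_index s))/=.
    by apply: eq_bigr => i _; rewrite entry_rank1_perm.
  exact/onW_bij/perm_index_bij.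
rewrite sumr_const card_Sn -[LHS]mulr_natl mulrA divff ?mul1r//.
Qed.

(** Moves the spike inside the symmetrization, so that the shift formula applies to i.i.d. entries,
    which those of the symmetrized noise are not. *)
Lemma symmetrize_addt_rank1 d n lam (x : n.-tuple R) (w : tensor R d n) :
  symmetrize (addt w (scalet lam (rank1 d x)) : tensor R d n) =
  spike lam (x, symmetrize w).
Proof.
apply: eq_from_entry => i; rewrite [LHS]mktensorE [RHS]mktensorE addrC/=.
under eq_bigr do rewrite entry_addt entry_scalet.
rewrite big_split/= mulrDr; congr (_ + _); first by rewrite mktensorE.
under eq_bigr => s _ do rewrite (entry_rank1_perm x s i).
rewrite sumr_const card_Sn mulrnAr -mulrnAl -[_^-1 *+ _]mulr_natr mulVf ?mul1r//.
Qed.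

Lemma dotp_rank1_spike d n lam (x y : n.-tuple R) (w : tensor R d n) :
  dotp (rank1 d y) (spike lam (x, w)) =
  lam * dotp y x ^+ d + dotp (rank1 d y) w.
Proof.
rewrite -dotp_rank1 !dotp_entry big_distrr -big_split/=; apply: eq_bigr => i _.
by rewrite [entry (spike _ _) _]mktensorE/=; ring.
Qed.

(** This form of Cauchy-Schwarz is linear in the two squared norms, hence can be integrated without
    square roots. *)
Lemma dotp_CS n (x y : n.-tuple R) (a : R) : 0 < a ->
  2 * dotp x y <= a * dotp x x + dotp y y / a.
Proof.
move=> a0; rewrite /dotp !big_distrr big_distrl -big_split/=.
apply: ler_sum => i _; set u := tnth x i; set v := tnth y i.
rewrite -subr_ge0 (_ : _ - _ = a * (u - v / a) ^+ 2); last first.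
  by field; rewrite gt_eqF.
by rewrite mulr_ge0 ?sqr_ge0 ?ltW.
Qed.

End tensor_algebra.

Section uniform_image_integral.
Context d (T : measurableType d) (R : realType) (I : finType).

Lemma ge0_integral_uniform_image (D : {set I}) (f : I -> T) (t0 : T)
    (g : T -> \bar R) :
  D != finset.set0 -> measurable_fun [set: T] g -> (forall x, 0 <= g x)%E ->
  (\int[uniform_image R D f t0]_x g x =
   (#|D|%:R^-1)%:E * \sum_(i in D) g (f i))%E.
Proof.
move=> D0 mg g0.
have [i0 i0D] : exists i0, i0 \in D by apply/set0Pn.
pose m k : {measure set T -> \bar R} := \d_(f (nth i0 (enum D) k)).
have c0 : (0 <= #|D|%:R^-1 :> R)%R by rewrite invr_ge0.
rewrite (eq_measure_integral (mscale (NngNum c0) (msum m #|D|))); last first.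
  move=> A mA _; rewrite /= /uniform_image (negbTE D0) /mscale/= /msum.
  congr (_ * _)%E; rewrite -big_enum/= (big_nth i0) big_mkord -cardE.
  by [].
rewrite ge0_integral_mscale// ge0_integral_measure_sum//=; congr (_ * _)%E.
rewrite -[RHS]big_enum/= [RHS](big_nth i0) [RHS]big_mkord -cardE.
by apply: eq_bigr => k _; rewrite integral_dirac// diracT mul1e.
Qed.

End uniform_image_integral.

(** * The truncated second moment *)

Section clamp.
Variable R : realType.

(** [1 + clamp r] is nonnegative and bounded, which brings the signed expectation of weak recovery
    within reach of the nonnegative integral lemmas. *)
Definition clamp (r : R) : R := Num.max (-1) (Num.min 1 r).

Lemma clampE r : `|r| <= 1 -> clamp r = r.
Proof.
by rewrite ler_norml => /andP[r0 r1]; rewrite /clamp min_r// max_r.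
Qed.

Lemma clamp_ge r : 0 <= 1 + clamp r.
Proof. by rewrite addrC -lerBlDr sub0r le_max lexx. Qed.

Lemma clamp_le r : 1 + clamp r <= 2.
Proof.
rewrite (_ : 2 = 1 + 1)// lerD2l ge_max ge_min lexx andbT.
by rewrite (le_trans (lerN10 R)).
Qed.

Lemma measurable_clamp d (T : measurableType d) (f : T -> R) :
  measurable_fun [set: T] f -> measurable_fun [set: T] (fun x => clamp (f x)).
Proof.
by move=> mf; apply: measurable_maxr => //; exact: measurable_minr.
Qed.

Lemma dotp_unit_le1 n (x y : n.-tuple R) :
  dotp x x = 1 -> dotp y y = 1 -> `|dotp x y| <= 1.
Proof.
move=> x1 y1; rewrite ler_norml; apply/andP; split.
  have := @dotp_CS R n (scalet (-1) x) y 1 ltr01.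
  by rewrite !dotpZl dotpZr x1 y1 => ?; lra.
by have := @dotp_CS R n x y 1 ltr01; rewrite x1 y1 => ?; lra.
Qed.

End clamp.

(** Here [p] and [t] stand for the masses of a test under the null law and under the mixture, [m]
    and [s] for the first two moments of the mixture. The main inequality itself makes [t] finite,
    and the rest is real arithmetic. *)
Lemma weak_detection_arith (R : realType) (p s m t : \bar R) (e M eta : R) :
  0 < eta -> p \is a fin_num -> (0 <= s)%E -> (0 <= m)%E -> (0 <= t)%E ->
  (t + (eta^-1)%:E * m <=
   p + (eta / 2 + (2 * eta)^-1)%:E + ((2 * eta)^-1)%:E * s)%E ->
  (1 - e%:E <= m)%E -> (m <= 1)%E -> (s <= M%:E)%E ->
  (t <= p + (eta / 2 + (M - 1 + 2 * e) / (2 * eta))%:E)%E.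
Proof.
move=> eta0 pf s0 m0 t0 key em m1 sM.
have ieta : 0 < eta^-1 by rewrite invr_gt0.
have mf : m \is a fin_num by rewrite ge0_fin_numE// (le_lt_trans m1)// ltry.
have sf : s \is a fin_num by rewrite ge0_fin_numE// (le_lt_trans sM)// ltry.
have tf : t \is a fin_num.
  rewrite ge0_fin_numE//.
  apply: (@le_lt_trans _ _ (t + (eta^-1)%:E * m)%E).
    by rewrite leeDl// mule_ge0// lee_fin ltW.
  apply: le_lt_trans key _.
  by rewrite -(fineK pf) -(fineK sf) -!EFinM -!EFinD ltry.
move: key em m1 sM.
rewrite -(fineK pf) -(fineK sf) -(fineK mf) -(fineK tf).
move: (fine p) (fine s) (fine m) (fine t) => {pf sf mf tf s0 m0 t0}p {}s {}m {}t.
rewrite -EFinB -!EFinM -!EFinD !lee_fin => key em m1 sM.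
have h1 : eta^-1 * (1 - e) <= eta^-1 * m by rewrite ler_pM2l.
have h2 : eta^-1 * s <= eta^-1 * M by rewrite ler_pM2l.
move: key; rewrite invfM => key.
have -> : (M - 1 + 2 * e) * (2^-1 * eta^-1) =
  2^-1 * (eta^-1 * M) + 2^-1 * eta^-1 - eta^-1 * (1 - e) by field; rewrite gt_eqF.
by lra.
Qed.

Section spiked_model.
Variables (R : realType) (d n : nat) (I : finType) (D : {set I}).
Variables (x : I -> n.-tuple R) (x0 : n.-tuple R) (X : prior R).
Hypothesis XE : X n = uniform_image R D x x0.
Hypothesis D0 : D != finset.set0.
Hypothesis n0 : (0 < n)%N.
Variable lam : R.

Local Notation N := (n%:R : R).
Local Notation sigma := (Num.sqrt (2 / N)).
Local Notation G := (iid (gaussian sigma) #|{: d.-tuple 'I_n}|).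
Local Notation h i := (rank1 d (x i)).

Lemma n_gt0 : 0 < N. Proof. by rewrite ltr0n. Qed.

Lemma sigma_sqr : sigma ^+ 2 = 2 / N.
Proof. by rewrite sqr_sqrtr// divr_ge0. Qed.

Lemma sigma_neq0 : sigma != 0.
Proof. by rewrite gt_eqF// sqrtr_gt0 divr_gt0// n_gt0. Qed.

Local Opaque iid.

Lemma ge0_integral_WT (g : tensor R d n -> R) :
  measurable_fun [set: tensor R d n] g -> (forall t, 0 <= g t) ->
  (\int[WT R d n]_t (g t)%:E = \int[G]_w (g (symmetrize w))%:E)%E.
Proof.
move=> mg g0; rewrite /WT ge0_integral_distribution//.
exact/measurable_EFinP.
Qed.

Lemma ge0_integral_spike_noise (g : n.-tuple R * tensor R d n -> R) :
  measurable_fun [set: n.-tuple R * tensor R d n] g -> (forall t, 0 <= g t) ->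
  (\int[spike_noise d n X]_p (g p)%:E =
   (#|D|%:R^-1)%:E * \sum_(i in D) \int[G]_w (g (x i, symmetrize w))%:E)%E.
Proof.
move=> mg g0; rewrite /spike_noise XE.
have mgE : measurable_fun [set: n.-tuple R * tensor R d n] (EFin \o g).
  exact/measurable_EFinP.
rewrite (fubini_tonelli1 (EFin \o g))//.
rewrite ge0_integral_uniform_image//; last 2 first.
- apply: (measurable_fun_fubini_tonelli_F (EFin \o g)) => //.
- by move=> y; apply: integral_ge0 => w _; rewrite lee_fin.
congr (_ * _)%E; apply: eq_bigr => i _.
apply: (ge0_integral_WT (g := fun t => g (x i, t))) => //.
exact: measurableT_comp.
Qed.

(** Given the spike, adding [lam] times its tensor to the noise amounts to multiplying by the
    tilt. *)
Lemma ge0_integral_spiked (g : n.-tuple R * tensor R d n -> R) :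
  measurable_fun [set: n.-tuple R * tensor R d n] g -> (forall t, 0 <= g t) ->
  (\int[spike_noise d n X]_p (g (p.1, spike lam p))%:E =
   (#|D|%:R^-1)%:E * \sum_(i in D) \int[G]_w
     (g (x i, symmetrize w) * tilt sigma (scalet lam (h i)) w)%:E)%E.
Proof.
move=> mg g0.
rewrite (ge0_integral_spike_noise (g := fun p => g (p.1, spike lam p)))//.
  congr (_ * _)%E; apply: eq_bigr => i _ /=.
  transitivity (\int[G]_w (g (x i, symmetrize
      (addt w (scalet lam (h i)) : tensor R d n)))%:E)%E.
    by apply: eq_integral => w _; rewrite symmetrize_addt_rank1.
  have mgi : measurable_fun [set: #|{: d.-tuple 'I_n}|.-tuple R]
      (fun w : tensor R d n => g (x i, symmetrize w)).
    apply: (measurableT_comp (f := fun t => g (x i, t))).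
      exact: measurableT_comp.
    exact: measurable_symmetrize.
  rewrite (ge0_integral_iid_shift sigma_neq0 _
    (f := fun w => (g (x i, symmetrize (w : tensor R d n)))%:E))//.
  - exact/measurable_EFinP.
  - by move=> w; rewrite lee_fin.
by apply: measurableT_comp => //; apply: measurable_fun_pair.
Qed.

(* [f] need not be bounded off the support of the prior, whence [clamp]. *)
Lemma expectation_bounded (f : n.-tuple R * tensor R d n -> R) :
  measurable_fun [set: n.-tuple R * tensor R d n] f ->
  (forall i t, i \in D -> `|f (x i, t)| <= 1) ->
  ('E_(spike_noise d n X)[f] =
   \int[spike_noise d n X]_p (1 + clamp (f p))%:E - 1)%E.
Proof.
move=> mf f1; rewrite unlock.
have mc := measurable_clamp mf.
have posE (g : R -> R) : (forall i t, i \in D -> g (f (x i, t)) = g (clamp (f (x i, t)))) ->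
    measurable_fun [set: R] g -> (forall r, 0 <= g r) ->
    (\int[spike_noise d n X]_p (g (f p))%:E =
     \int[spike_noise d n X]_p (g (clamp (f p)))%:E)%E.
  move=> gE mg g0.
  rewrite (ge0_integral_spike_noise (g := fun p => g (f p)))//; last first.
    exact: measurableT_comp.
  rewrite (ge0_integral_spike_noise (g := fun p => g (clamp (f p))))//; last first.
    exact: measurableT_comp.
  congr (_ * _)%E; apply: eq_bigr => i iD; apply: eq_integral => w _.
  by rewrite gE.
have fE (g : R -> R) i t : i \in D -> g (f (x i, t)) = g (clamp (f (x i, t))) :> R.
  by move=> iD; rewrite clampE// f1.
have -> : (\int[spike_noise d n X]_p (f p)%:E =
    \int[spike_noise d n X]_p (clamp (f p))%:E)%E.
  (* Positive and negative parts are compared separately; each is a nonnegative integral, which sees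
     only the support of the prior. *)
  have nE (u : n.-tuple R * tensor R d n -> R) :
    (\int[spike_noise d n X]_p (u p)%:E =
     \int[spike_noise d n X]_p (Num.max (u p) 0)%:E -
     \int[spike_noise d n X]_p (Num.max (- u p) 0)%:E)%E.
    rewrite integralE; congr (_ - _)%E; apply: eq_integral => p _.
      by rewrite funeposE -EFin_max.
    by rewrite funenegE -EFinN -EFin_max.
  rewrite (nE f) (nE (fun p => clamp (f p))); congr (_ - _)%E.
    apply: (posE (fun r => Num.max r 0)).
    - by move=> i t iD; exact: (fE (fun r => Num.max r 0)).
    - exact: measurable_maxr.
    - by move=> r; rewrite le_max lexx orbT.
  apply: (posE (fun r => Num.max (- r) 0)).
  - by move=> i t iD; exact: (fE (fun r => Num.max (- r) 0)).
  - by apply: measurable_maxr => //; exact: measurable_oppr.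
  - by move=> r; rewrite le_max lexx orbT.
have ic : (spike_noise d n X).-integrable setT (fun p => (clamp (f p))%:E).
  apply: (le_integrable measurableT _ _
    (finite_measure_integrable_cst _ 1 measurableT)).
  - exact/measurable_EFinP.
  - move=> p _ /=; rewrite lee_fin normr1 ler_norml.
    by have := clamp_ge (f p); have := clamp_le (f p) => ? ?; apply/andP; split; lra.
under [in RHS]eq_integral do rewrite EFinD.
rewrite integralD//; last exact: finite_measure_integrable_cst.
rewrite integral_cst//= probability_setT mule1 addeAC subee// add0e.
by [].
Qed.

Hypothesis x1 : forall i, i \in D -> dotp (x i) (x i) = 1.
Variable del : R.
Hypotheses (lam0 : 0 <= lam) (del0 : 0 < del).

Local Notation likelihood i := (tilt sigma (scalet lam (h i))).
Local Notation overlap i j := (dotp (x i) (x j) ^+ d).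

Definition small_score (i : I) : set (tensor R d n) :=
  [set w | dotp (h i) w <= lam + del].

Definition trunc_likelihood (i : I) (w : tensor R d n) : R :=
  likelihood i w * \1_(small_score i) w.

Lemma likelihoodE i w : i \in D ->
  likelihood i w = expR (lam * N / 2 * dotp (h i) w - lam ^+ 2 * N / 4).
Proof.
move=> iD; rewrite /tilt sigma_sqr !dotpZl !dotpZr dotp_rank1 x1// expr1n.
by congr expR; field; rewrite gt_eqF// n_gt0.
Qed.

Lemma measurable_small_score i : measurable (small_score i).
Proof.
rewrite -[X in measurable X]setTI.
by apply: measurable_fun_le => //; exact: measurable_dotp.
Qed.

Lemma measurable_trunc_likelihood i :
  measurable_fun [set: tensor R d n] (trunc_likelihood i).
Proof.
apply: measurable_funM; first exact: measurable_tilt.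
by apply: measurable_indic; exact: measurable_small_score.
Qed.

Lemma trunc_likelihood_ge0 i w : 0 <= trunc_likelihood i w.
Proof. by rewrite mulr_ge0// tilt_ge0. Qed.

Lemma trunc_likelihood_le i w : trunc_likelihood i w <= likelihood i w.
Proof. by rewrite ler_piMr ?tilt_ge0// indicE lern1 leq_b1. Qed.

Lemma integral_likelihood i : (\int[G]_w (likelihood i w)%:E = 1)%E.
Proof.
have := ge0_integral_iid_shift sigma_neq0 (scalet lam (h i))
  (f := cst 1%E) (measurable_cst _) (fun=> lee01).
rewrite integral_cst//= probability_setT mule1 => ->.
by apply: eq_integral => w _; rewrite mul1e.
Qed.

Lemma integral_trunc_likelihood_le1 i :
  (\int[G]_w (trunc_likelihood i w)%:E <= 1)%E.
Proof.
rewrite -(integral_likelihood i); apply: le_integral_EFin.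
- exact: measurable_trunc_likelihood.
- exact: measurable_tilt.
- exact: trunc_likelihood_ge0.
- exact: trunc_likelihood_le.
Qed.

(** Gaussian tail at [del] for the noise score of a unit vector, whose variance is [2 / n]. *)
Definition score_tail : R := expR (- (N * del ^+ 2 / 4)).

(** Undoing the tilt recentres the score at [lam], so the truncation discards only the event that
    pure noise exceeds [del]. *)
Lemma integral_large_score i : i \in D ->
  (\int[G]_w (likelihood i w * \1_(~` small_score i) w)%:E
   <= score_tail%:E)%E.
Proof.
move=> iD.
have mC : measurable (~` small_score i).
  by apply: measurableC; exact: measurable_small_score.
have := ge0_integral_iid_shift sigma_neq0 (scalet lam (h i))
  (f := fun w => (\1_(~` small_score i) w)%:E).
have -> : (\int[G]_w (likelihood i w * \1_(~` small_score i) w)%:E =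
    \int[G]_w ((\1_(~` small_score i) w)%:E * (likelihood i w)%:E))%E.
  by apply: eq_integral => w _; rewrite -EFinM mulrC.
move=> <-; last 2 first.
- by apply/measurable_EFinP; exact: measurable_indic.
- by move=> w; rewrite lee_fin.
have mT : measurable [set w : tensor R d n | del <= dotp (h i) w].
  rewrite -[X in measurable X]setTI.
  by apply: measurable_fun_le => //; exact: measurable_dotp.
apply: (@le_trans _ _ (G [set w | (del <= dotp (h i) w)%R])).
  rewrite -[X in (_ <= G X)%E]setIT -integral_indic//.
  apply: le_integral_EFin => //.
  - have mI : measurable_fun [set: tensor R d n]
        (\1_(~` small_score i) : tensor R d n -> R) by exact: measurable_indic.
    exact: (measurableT_comp mI (measurable_addt _)).
  - move=> w; rewrite !indicE ler_nat.
    have [|//] := boolP (addt w _ \in _).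
    rewrite inE /small_score/= => /negP; rewrite -ltNge dotpDr dotpZr.
    rewrite dotp_rank1 x1// expr1n mulr1 addrC ltrD2r => lt.
    by rewrite mem_set//= ltW.
apply: le_trans (iid_dotp_tail sigma_neq0 (ltW del0) _) _.
  by rewrite dotp_rank1 x1// expr1n.
rewrite lee_fin /score_tail sigma_sqr ler_expR le_eqVlt; apply/orP; left.
by apply/eqP; field; rewrite gt_eqF// n_gt0.
Qed.

Lemma integral_trunc_likelihood_ge i : i \in D ->
  (1 - score_tail%:E <= \int[G]_w (trunc_likelihood i w)%:E)%E.
Proof.
move=> iD; rewrite leeBlDr// -(integral_likelihood i).
have mC : measurable (~` small_score i).
  by apply: measurableC; exact: measurable_small_score.
have mL : measurable_fun [set: tensor R d n]
    (fun w => likelihood i w * \1_(~` small_score i) w).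
  by apply: measurable_funM; [exact: measurable_tilt|exact: measurable_indic].
have L0 w : 0 <= likelihood i w * \1_(~` small_score i) w.
  by rewrite mulr_ge0// tilt_ge0.
apply: (@le_trans _ _ (\int[G]_w (trunc_likelihood i w)%:E +
  \int[G]_w (likelihood i w * \1_(~` small_score i) w)%:E)%E).
  rewrite -integral_EFinD//.
  - apply: le_integral_EFin => //.
    + exact: measurable_tilt.
    + by apply: measurable_funD => //; exact: measurable_trunc_likelihood.
    + by move=> w; rewrite tilt_ge0.
    + move=> w; rewrite /trunc_likelihood -mulrDr !indicE in_setC.
      by case: (_ \in _); rewrite /= ?addr0 ?add0r mulr1.
  - exact: measurable_trunc_likelihood.
  - exact: trunc_likelihood_ge0.
by rewrite leeD2l//; exact: integral_large_score.
Qed.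

(* Chernoff bound for both cutoffs at once: [theta] is the multiplier. *)
Lemma trunc_second_moment_chernoff i j a theta : i \in D -> j \in D ->
  0 <= theta -> a + theta = lam / 2 ->
  (\int[G]_w (trunc_likelihood i w * trunc_likelihood j w)%:E <=
   (expR (N * (2 * a ^+ 2 * (1 + overlap i j) +
               2 * theta * (lam + del) - lam ^+ 2 / 2)))%:E)%E.
Proof.
move=> iD jD th0 athE.
pose v : tensor R d n := scalet (N * a) (addt (h i) (h j)).
pose C := expR (N * (2 * theta * (lam + del) - lam ^+ 2 / 2)).
have mv : measurable_fun [set: tensor R d n] (fun w => expR (dotp v w)).
  by apply: measurableT_comp => //; exact: measurable_dotp.
apply: (@le_trans _ _ (\int[G]_w (C * expR (dotp v w))%:E)%E).
  apply: le_integral_EFin.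
  - by apply: measurable_funM; exact: measurable_trunc_likelihood.
  - exact: measurable_funM.
  - by move=> w; rewrite mulr_ge0 ?trunc_likelihood_ge0.
  - move=> w; rewrite /trunc_likelihood !indicE.
    have [|_] := boolP (w \in small_score i); last first.
      by rewrite mulr0 mul0r mulr_ge0 ?expR_ge0.
    have [|_ _] := boolP (w \in small_score j); last first.
      by rewrite !mulr0 mulr_ge0 ?expR_ge0.
    rewrite !inE /small_score/= => uj ui; rewrite !mulr1 !likelihoodE// -!expRD.
    rewrite ler_expR dotpZl dotpDl; set u := dotp _ w in ui *.
    set u' := dotp _ w in uj *.
    have aE : a = lam / 2 - theta by rewrite -athE addrK.
    rewrite aE -subr_ge0.
    (* The gap between the exponents is [theta] times the distances of both scores to the cutoff,
       nonnegative where neither is truncated. *)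
    have -> : N * (2 * theta * (lam + del) - lam ^+ 2 / 2) +
      N * (lam / 2 - theta) * (u + u') -
      (lam * N / 2 * u - lam ^+ 2 * N / 4 +
       (lam * N / 2 * u' - lam ^+ 2 * N / 4)) =
      N * theta * ((lam + del - u) + (lam + del - u')) by field.
    apply: mulr_ge0; first exact: mulr_ge0.
    by rewrite addr_ge0 ?subr_ge0.
rewrite integral_EFinZl ?expR_ge0// integral_iid_expR ?sigma_neq0//.
rewrite -EFinM lee_fin -expRD ler_expR sigma_sqr !dotpZl !dotpZr !dotpDl !dotpDr.
rewrite !dotp_rank1 !x1// expr1n (dotpC (x j)) le_eqVlt; apply/orP; left.
by apply/eqP; field; rewrite gt_eqF// n_gt0.
Qed.

(** The Chernoff exponent at the optimal [theta]; [2 * lam * del] is the price of the margin [del]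
    in the cutoff. *)
Definition second_moment_exponent (s : R) : R :=
  N / 2 * (lam ^+ 2 + 2 * lam * del) * (Num.max 0 s / (1 + Num.max 0 s)).

(* [theta] is the optimal multiplier when the overlap is nonnegative. *)
Lemma trunc_second_moment i j : i \in D -> j \in D ->
  (\int[G]_w (trunc_likelihood i w * trunc_likelihood j w)%:E <=
   (expR (second_moment_exponent (overlap i j)))%:E)%E.
Proof.
move=> iD jD; rewrite /second_moment_exponent.
have [s0|s0] := leP 0 (overlap i j).
  have s1 : 0 < 1 + overlap i j by rewrite ltr_pwDl.
  apply: le_trans (trunc_second_moment_chernoff (a := lam / (2 * (1 + overlap i j)))
    (theta := lam * overlap i j / (2 * (1 + overlap i j))) iD jD _ _) _.
  - by apply: divr_ge0; [exact: mulr_ge0|rewrite mulr_ge0// ltW].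
  - by field; rewrite gt_eqF.
  rewrite lee_fin ler_expR le_eqVlt; apply/orP; left; apply/eqP; field.
  by rewrite gt_eqF.
(* A negative overlap, possible only for odd [d]: the exponent is nonpositive even without
   truncation. *)
apply: le_trans (trunc_second_moment_chernoff (a := lam / 2)
    (theta := 0) iD jD _ _) _ => //; first by rewrite addr0.
rewrite lee_fin ler_expR [0 / _]mul0r [X in _ <= X]mulr0 -subr_le0.
have -> : N * (2 * (lam / 2) ^+ 2 * (1 + overlap i j) + 2 * 0 * (lam + del) -
   lam ^+ 2 / 2) - 0 = N * lam ^+ 2 * overlap i j / 2 by field.
rewrite pmulr_lle0 ?invr_gt0// mulr_ge0_le0 ?(ltW s0)// mulr_ge0 ?sqr_ge0//.
Qed.

Local Notation q := (#|D|%:R^-1 : R).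

Definition mixture (w : tensor R d n) : R :=
  q * \sum_(i in D) trunc_likelihood i w.

(** The weight [cst 1] serves detection, [Num.max 0] serves recovery. *)
Definition weighted_second_moment (W : R -> R) : R :=
  q * (q * \sum_(i in D) \sum_(j in D)
    W (overlap i j) * expR (second_moment_exponent (overlap i j))).

Lemma card_inv_ge0 : 0 <= q. Proof. by rewrite invr_ge0. Qed.

Lemma sum_card_inv (c : R) : q * \sum_(i in D) c = c.
Proof.
rewrite sumr_const mulrnAr -mulrnAl -[_^-1 *+ _]mulr_natr mulVf ?mul1r//.
by rewrite pnatr_eq0 cards_eq0.
Qed.

Lemma esum_card_inv (c : R) : (q%:E * \sum_(i in D) c%:E = c%:E)%E.
Proof. by rewrite sumEFin -EFinM sum_card_inv. Qed.

Lemma mixture_ge0 w : 0 <= mixture w.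
Proof.
rewrite mulr_ge0 ?card_inv_ge0// sumr_ge0// => i _.
exact: trunc_likelihood_ge0.
Qed.

Lemma measurable_sum_trunc (g : I -> tensor R d n -> R) :
  (forall i, measurable_fun [set: tensor R d n] (g i)) ->
  measurable_fun [set: tensor R d n]
    (fun w => \sum_(i in D) g i w * trunc_likelihood i w).
Proof.
move=> mg.
rewrite (_ : (fun _ => _) = (fun w => \sum_(i <- enum D)
   g i w * trunc_likelihood i w)); last first.
  by apply/funext => w; rewrite big_enum.
apply: measurable_sum => i; apply: measurable_funM => //.
exact: measurable_trunc_likelihood.
Qed.

Lemma measurable_mixture : measurable_fun [set: tensor R d n] mixture.
Proof.
apply: measurable_funM => //.
rewrite (_ : (fun _ => _) = (fun w => \sum_(i in D)
   1 * trunc_likelihood i w)); first exact: measurable_sum_trunc.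
by apply/funext => w; apply: eq_bigr => i _; rewrite mul1r.
Qed.

Lemma integral_mixtureE :
  (\int[G]_w (mixture w)%:E =
   q%:E * \sum_(i in D) \int[G]_w (trunc_likelihood i w)%:E)%E.
Proof.
rewrite integral_EFinZl ?card_inv_ge0//.
- rewrite integral_EFin_sum// => [i|i w]; first exact: measurable_trunc_likelihood.
  exact: trunc_likelihood_ge0.
- rewrite (_ : (fun _ => _) = (fun w => \sum_(i in D)
   1 * trunc_likelihood i w)); first exact: measurable_sum_trunc.
  by apply/funext => w; apply: eq_bigr => i _; rewrite mul1r.
- by move=> w; apply: sumr_ge0 => i _; exact: trunc_likelihood_ge0.
Qed.

Lemma integral_mixture_le1 : (\int[G]_w (mixture w)%:E <= 1)%E.
Proof.
rewrite integral_mixtureE -(esum_card_inv 1).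
rewrite lee_wpmul2l ?lee_fin ?card_inv_ge0//; apply: lee_sum => i _.
exact: integral_trunc_likelihood_le1.
Qed.

Lemma integral_mixture_ge : (1 - score_tail%:E <= \int[G]_w (mixture w)%:E)%E.
Proof.
rewrite integral_mixtureE -EFinB -(esum_card_inv (1 - score_tail)).
rewrite lee_wpmul2l ?lee_fin ?card_inv_ge0//; apply: lee_sum => i iD.
exact: integral_trunc_likelihood_ge.
Qed.

Lemma measurable_double_trunc (W : R -> R) :
  measurable_fun [set: tensor R d n] (fun w => \sum_(i in D) \sum_(j in D)
   W (overlap i j) * (trunc_likelihood i w * trunc_likelihood j w)).
Proof.
rewrite (_ : (fun _ => _) = (fun w => \sum_(i in D) (\sum_(j in D)
   W (overlap i j) * trunc_likelihood j w) * trunc_likelihood i w)).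
  apply: measurable_sum_trunc => i; exact: measurable_sum_trunc.
apply/funext => w; apply: eq_bigr => i _; rewrite big_distrl/=.
by apply: eq_bigr => j _; rewrite mulrA mulrAC.
Qed.

Lemma integral_weighted_second_moment (W : R -> R) : (forall s, 0 <= W s) ->
  (\int[G]_w (q * (q * \sum_(i in D) \sum_(j in D) W (overlap i j) *
      (trunc_likelihood i w * trunc_likelihood j w)))%:E <=
   (weighted_second_moment W)%:E)%E.
Proof.
move=> W0.
have t0 i j w : 0 <= W (overlap i j) *
    (trunc_likelihood i w * trunc_likelihood j w).
  by apply: mulr_ge0 => //; apply: mulr_ge0; exact: trunc_likelihood_ge0.
have mt i j : measurable_fun [set: tensor R d n] (fun w => W (overlap i j) *
    (trunc_likelihood i w * trunc_likelihood j w)).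
  by apply: measurable_funM => //; apply: measurable_funM;
    exact: measurable_trunc_likelihood.
have s0 w : 0 <= \sum_(i in D) \sum_(j in D) W (overlap i j) *
    (trunc_likelihood i w * trunc_likelihood j w).
  by apply: sumr_ge0 => i _; apply: sumr_ge0.
have ms := measurable_double_trunc W.
rewrite integral_EFinZl ?card_inv_ge0//; last 2 first.
- exact: measurable_funM.
- by move=> w; rewrite mulr_ge0 ?card_inv_ge0.
rewrite integral_EFinZl ?card_inv_ge0//.
rewrite /weighted_second_moment !EFinM.
do 2 (rewrite lee_wpmul2l ?lee_fin ?card_inv_ge0//).
rewrite integral_EFin_sum; last 2 first.
- move=> i; rewrite (_ : (fun _ => _) = (fun w => \sum_(j <- enum D)
     W (overlap i j) * (trunc_likelihood i w * trunc_likelihood j w))).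
    exact: measurable_sum.
  by apply/funext => w; rewrite big_enum.
- by move=> i w; apply: sumr_ge0.
rewrite -sumEFin; apply: lee_sum => i iD.
rewrite integral_EFin_sum// -sumEFin; apply: lee_sum => j jD.
rewrite integral_EFinZl//; last 2 first.
- by apply: measurable_funM; exact: measurable_trunc_likelihood.
- by move=> w; rewrite mulr_ge0 ?trunc_likelihood_ge0.
by rewrite EFinM lee_wpmul2l ?lee_fin//; exact: trunc_second_moment.
Qed.

Lemma mixture_sqrE w : mixture w ^+ 2 =
  q * (q * \sum_(i in D) \sum_(j in D)
    1 * (trunc_likelihood i w * trunc_likelihood j w)).
Proof.
rewrite /mixture expr2 mulrACA -mulrA; congr (_ * (_ * _)).
rewrite big_distrlr/=.
by apply: eq_bigr => i _; apply: eq_bigr => j _; rewrite mul1r.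
Qed.

Lemma integral_mixture_sqr :
  (\int[G]_w (mixture w ^+ 2)%:E <= (weighted_second_moment (cst 1))%:E)%E.
Proof.
under eq_integral do rewrite mixture_sqrE.
exact: integral_weighted_second_moment.
Qed.

(** On the truncated part [g] is at most [c], and the spiked mass of that part is at most
    [score_tail]. *)
Lemma integral_spiked_le (g : n.-tuple R * tensor R d n -> R) (c : R) :
  measurable_fun [set: n.-tuple R * tensor R d n] g ->
  (forall t, 0 <= g t) -> (forall i t, i \in D -> g (x i, t) <= c) ->
  (\int[spike_noise d n X]_p (g (p.1, spike lam p))%:E <=
   \int[G]_w (q * \sum_(i in D)
      g (x i, symmetrize w) * trunc_likelihood i w)%:E + (c * score_tail)%:E)%E.
Proof.
move=> mg g0 gc; rewrite ge0_integral_spiked//.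
have mgi i : measurable_fun [set: tensor R d n]
    (fun w : tensor R d n => g (x i, symmetrize w)).
  apply: (measurableT_comp (f := fun t => g (x i, t))).
    exact: measurableT_comp.
  exact: measurable_symmetrize.
have gt0 i w : 0 <= g (x i, symmetrize w) * trunc_likelihood i w.
  by rewrite mulr_ge0 ?trunc_likelihood_ge0.
rewrite integral_EFinZl ?card_inv_ge0//; last 2 first.
- exact: measurable_sum_trunc.
- by move=> w; apply: sumr_ge0.
rewrite integral_EFin_sum//; last first.
  by move=> i; apply: measurable_funM => //; exact: measurable_trunc_likelihood.
rewrite -(esum_card_inv (c * score_tail)) -muleDr//; last first.
  apply: ge0_adde_def; rewrite inE.
    by apply: sume_ge0 => i _; apply: integral_ge0 => w _; rewrite lee_fin.
  have [i iD] : exists i, i \in D by apply/set0Pn.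
  apply: sume_ge0 => j _; rewrite lee_fin mulr_ge0 ?expR_ge0//.
  exact: le_trans (g0 (x i, mktensor (fun=> 0))) (gc _ _ iD).
rewrite lee_wpmul2l ?lee_fin ?card_inv_ge0// -big_split/=.
apply: lee_sum => i iD.
have mC : measurable (~` small_score i).
  by apply: measurableC; exact: measurable_small_score.
have c0 : 0 <= c.
  exact: le_trans (g0 (x i, mktensor (fun=> 0))) (gc _ _ iD).
have mL : measurable_fun [set: tensor R d n]
    (fun w => likelihood i w * \1_(~` small_score i) w).
  by apply: measurable_funM; [exact: measurable_tilt|exact: measurable_indic].
have L0 w : 0 <= likelihood i w * \1_(~` small_score i) w.
  by rewrite mulr_ge0// tilt_ge0.
apply: (@le_trans _ _ (\int[G]_w
    (g (x i, symmetrize w) * trunc_likelihood i w)%:E + \int[G]_w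
    (c * (likelihood i w * \1_(~` small_score i) w))%:E)%E).
  rewrite -integral_EFinD//.
  - apply: le_integral_EFin => //.
    + by apply: measurable_funM => //; exact: measurable_tilt.
    + apply: measurable_funD; last exact: measurable_funM.
      by apply: measurable_funM => //; exact: measurable_trunc_likelihood.
    + by move=> w; rewrite mulr_ge0// tilt_ge0.
    + move=> w; rewrite /trunc_likelihood !indicE in_setC.
      case: (_ \in _); rewrite /= ?mulr1 ?mulr0 ?addr0 ?add0r//.
      by rewrite ler_wpM2r ?tilt_ge0// gc.
  - by apply: measurable_funM => //; exact: measurable_trunc_likelihood.
  - exact: measurable_funM.
  - by move=> w; rewrite mulr_ge0.
rewrite leeD2l// integral_EFinZl// EFinM lee_wpmul2l ?lee_fin//.
exact: integral_large_score.
Qed.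

Lemma WT_indic (A : set (tensor R d n)) : measurable A ->
  (WT R d n A = \int[G]_w (\1_A (symmetrize w) : R)%:E)%E.
Proof.
move=> mA; rewrite -[in LHS](setIT A) -integral_indic//.
rewrite (ge0_integral_WT (g := \1_A))//.
Qed.

Lemma spikedWT_indic (A : set (tensor R d n)) : measurable A ->
  (spikedWT d n lam X A =
   \int[spike_noise d n X]_p (\1_A (spike lam p) : R)%:E)%E.
Proof.
move=> mA.
have mS : measurable (spike (d := d) lam @^-1` A : set (n.-tuple R * tensor R d n)).
  by rewrite -[X in measurable X]setTI; exact: measurable_spike.
rewrite [LHS]/= /distribution /pushforward -[X in spike_noise _ _ _ X]setIT.
by rewrite -integral_indic//; apply: eq_integral => p _; rewrite !indicE.
Qed.

Local Notation M := (weighted_second_moment (cst 1)).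

Lemma measurable_indic_symmetrize (A : set (tensor R d n)) : measurable A ->
  measurable_fun [set: tensor R d n] (fun w => \1_A (symmetrize w) : R).
Proof.
move=> mA; apply: (measurableT_comp (f := \1_A : tensor R d n -> R)).
  exact: measurable_indic.
exact: measurable_symmetrize.
Qed.

Lemma spikedWT_le_mixture (A : set (tensor R d n)) : measurable A ->
  (spikedWT d n lam X A <= \int[G]_w (\1_A (symmetrize w) * mixture w)%:E +
    score_tail%:E)%E.
Proof.
move=> mA; rewrite spikedWT_indic// -[score_tail]mul1r.
have mI : measurable_fun [set: tensor R d n] (\1_A : tensor R d n -> R).
  exact: measurable_indic.
apply: le_trans (integral_spiked_le (g := fun p => \1_A p.2) (c := 1) _ _ _) _.
- exact: measurableT_comp.
- by [].
- by move=> i t _; rewrite indicE lern1 leq_b1.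
rewrite leeD2r// le_eqVlt; apply/orP; left; apply/eqP.
by apply: eq_integral => w _; rewrite /mixture mulrCA [in RHS]big_distrr.
Qed.

Lemma measurable_mixture_sqr :
  measurable_fun [set: tensor R d n] (fun w => mixture w ^+ 2).
Proof. by apply: measurable_funX; exact: measurable_mixture. Qed.

(** On [A], AM-GM gives [mixture <= eta / 2 * mixture ^+ 2 + (2 * eta)^-1]. With [M] bounded this is
    quantitative contiguity: an event rare under the null law cannot be almost sure under the spiked
    one. *)
Lemma spikedWT_le_strong (A : set (tensor R d n)) (eta : R) :
  measurable A -> 0 < eta ->
  (spikedWT d n lam X A <=
   (eta / 2 * M + score_tail)%:E + ((2 * eta)^-1)%:E * WT R d n A)%E.
Proof.
move=> mA eta0; apply: le_trans (spikedWT_le_mixture mA) _.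
rewrite [(eta / 2 * M + score_tail)%:E]EFinD [X in (_ <= X)%E]addeAC leeD2r//.
have mI := measurable_indic_symmetrize mA.
have eta2 : 0 <= eta / 2 by rewrite divr_ge0// ltW.
have ieta2 : 0 <= (2 * eta)^-1 by rewrite invr_ge0 mulr_ge0// ltW.
apply: (@le_trans _ _ (\int[G]_w (eta / 2 * mixture w ^+ 2 +
    (2 * eta)^-1 * \1_A (symmetrize w))%:E)%E).
  apply: le_integral_EFin.
  - by apply: measurable_funM => //; exact: measurable_mixture.
  - apply: measurable_funD; apply: measurable_funM => //.
    exact: measurable_mixture_sqr.
  - by move=> w; rewrite mulr_ge0// mixture_ge0.
  - move=> w; rewrite indicE; case: (_ \in _); last first.
      by rewrite mul0r mulr0 addr0 mulr_ge0// sqr_ge0.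
    rewrite mul1r mulr1 -subr_ge0.
    have -> : eta / 2 * mixture w ^+ 2 + (2 * eta)^-1 - mixture w =
      (2 * eta)^-1 * (eta * mixture w - 1) ^+ 2 by field; rewrite gt_eqF.
    by rewrite mulr_ge0// sqr_ge0.
rewrite integral_EFinD; last 4 first.
- by apply: measurable_funM => //; exact: measurable_mixture_sqr.
- exact: measurable_funM.
- by move=> w; rewrite mulr_ge0// sqr_ge0.
- by move=> w; rewrite mulr_ge0.
rewrite integral_EFinZl//; last 2 first.
- exact: measurable_mixture_sqr.
- by move=> w; rewrite sqr_ge0.
rewrite integral_EFinZl// -WT_indic// leeD2r// [(eta / 2 * M)%:E]EFinM.
rewrite lee_wpmul2l ?lee_fin//; exact: integral_mixture_sqr.
Qed.

(** With [L] the mixture, [1_A * (L - 1) <= eta / 2 + (L - 1) ^+ 2 / (2 * eta)], and the mean of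
    [(L - 1) ^+ 2] is at most [M - 1 + 2 * score_tail]. *)
Lemma spikedWT_le_weak (A : set (tensor R d n)) (eta : R) :
  measurable A -> 0 < eta ->
  (spikedWT d n lam X A <=
   WT R d n A + (eta / 2 + (M - 1 + 2 * score_tail) / (2 * eta) + score_tail)%:E)%E.
Proof.
move=> mA eta0; apply: le_trans (spikedWT_le_mixture mA) _.
rewrite [(_ + score_tail)%:E]EFinD [X in (_ <= X)%E]addeA leeD2r//.
have mI := measurable_indic_symmetrize mA.
have mX := measurable_mixture.
have mX2 := measurable_mixture_sqr.
have ieta : 0 <= eta^-1 by rewrite invr_ge0 ltW.
have eta2 : 0 <= eta / 2 by rewrite divr_ge0// ltW.
have ieta2 : 0 <= (2 * eta)^-1 by rewrite invr_ge0 mulr_ge0// ltW.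
have mIX : measurable_fun [set: tensor R d n]
    (fun w => \1_A (symmetrize w) * mixture w) by exact: measurable_funM.
have IX0 w : 0 <= \1_A (symmetrize w : tensor R d n) * mixture w.
  by rewrite mulr_ge0// mixture_ge0.
(* The cross term [- L / eta] of the expanded square stands on the left, so that all integrands are
   nonnegative. *)
have key : (\int[G]_w (\1_A (symmetrize w) * mixture w)%:E +
    (eta^-1)%:E * \int[G]_w (mixture w)%:E <=
    WT R d n A + (eta / 2 + (2 * eta)^-1)%:E +
    ((2 * eta)^-1)%:E * \int[G]_w (mixture w ^+ 2)%:E)%E.
  rewrite -integral_EFinZl//; last exact: mixture_ge0.
  rewrite -integral_EFinZl//; last by move=> w; rewrite sqr_ge0.
  rewrite -integral_EFinD//; last 2 first.
  - exact: measurable_funM.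
  - by move=> w; rewrite mulr_ge0// mixture_ge0.
  rewrite WT_indic//.
  have -> : (eta / 2 + (2 * eta)^-1)%:E =
      (\int[G]_w (eta / 2 + (2 * eta)^-1)%:E)%E.
    by rewrite integral_cst//= probability_setT mule1.
  rewrite -integral_EFinD//; last by move=> w; rewrite addr_ge0.
  rewrite -integral_EFinD//; last 4 first.
  - exact: measurable_funD.
  - exact: measurable_funM.
  - by move=> w; rewrite addr_ge0// addr_ge0.
  - by move=> w; rewrite mulr_ge0// sqr_ge0.
  apply: le_integral_EFin.
  - by apply: measurable_funD => //; exact: measurable_funM.
  - by apply: measurable_funD; [exact: measurable_funD|exact: measurable_funM].
  - by move=> w; rewrite addr_ge0// mulr_ge0// mixture_ge0.
  move=> w; rewrite indicE; set L := mixture w.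
  rewrite -subr_ge0; case: (_ \in _).
    have -> : 1 + (eta / 2 + (2 * eta)^-1) + (2 * eta)^-1 * L ^+ 2 -
        (1 * L + eta^-1 * L) = (2 * eta)^-1 * (L - 1 - eta) ^+ 2.
      by field; rewrite gt_eqF.
    by rewrite mulr_ge0// sqr_ge0.
  have -> : 0 + (eta / 2 + (2 * eta)^-1) + (2 * eta)^-1 * L ^+ 2 -
      (0 * L + eta^-1 * L) = eta / 2 + (2 * eta)^-1 * (L - 1) ^+ 2.
    by field; rewrite gt_eqF.
  by rewrite addr_ge0// mulr_ge0// sqr_ge0.
have := integral_mixture_ge; have := integral_mixture_le1.
have := integral_mixture_sqr.
have := fin_num_measure (WT R d n) A mA.
have int_ge0 (f : tensor R d n -> R) : (forall w, 0 <= f w) ->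
    (0 <= \int[G]_w (f w)%:E)%E.
  by move=> f0; apply: integral_ge0 => w _; rewrite lee_fin.
have s0 := int_ge0 _ (fun w => sqr_ge0 (mixture w)).
have m0 := int_ge0 _ mixture_ge0.
have t0 := int_ge0 _ IX0.
move=> pf sM m1 em; exact: (weak_detection_arith eta0 pf s0 m0 t0 key em m1 sM).
Qed.

Local Notation M' := (weighted_second_moment (Num.max 0)).

(** For fixed noise, the averaged overlap of an estimate is the inner product of its unit rank-one
    tensor with one tensor [F] that does not depend on the estimator. The squared norm of [F] is a
    sum over pairs weighted by their overlap, whence [M']. *)
Lemma recovery_le (xhat : {mfun tensor R d n >-> n.-tuple R}) (eta : R) :
  (forall t, dotp (xhat t) (xhat t) = 1) -> 0 < eta ->
  ('E_(spike_noise d n X)[fun p => (dotp p.1 (xhat (spike lam p)) ^+ d)%R] <=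
   (eta / 2 + M' / (2 * eta) + 2 * score_tail)%:E)%E.
Proof.
move=> xh1 eta0.
pose f (p : n.-tuple R * tensor R d n) := dotp p.1 (xhat p.2) ^+ d.
have mf : measurable_fun [set: n.-tuple R * tensor R d n] f.
  apply: measurable_funX; apply: measurable_sum => k; apply: measurable_funM.
    exact: measurableT_comp (measurable_tnth _) measurable_fst.
  apply: measurableT_comp (measurable_tnth _) _.
  exact: measurableT_comp measurable_snd.
have f1 i t : i \in D -> `|f (x i, t)| <= 1.
  move=> iD; rewrite /f normrX exprn_ile1//; apply: dotp_unit_le1 => //.
  exact: x1.
rewrite (expectation_bounded (f := fun p => f (p.1, spike lam p))); last 2 first.
- by apply: measurableT_comp => //; apply: measurable_fun_pair.
- by move=> i t iD; exact: f1.
rewrite leeBlDr//.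
have mc : measurable_fun [set: n.-tuple R * tensor R d n]
    (fun p => 1 + clamp (f p)).
  by apply: measurable_funD => //; exact: measurable_clamp.
apply: le_trans (integral_spiked_le (g := fun p => 1 + clamp (f p)) (c := 2) mc _ _) _.
- by move=> p; rewrite clamp_ge.
- by move=> i t _; rewrite clamp_le.
rewrite [X in (_ <= X%:E + _)%E]addrC [X in (_ <= X + _)%E]EFinD.
rewrite -addeA [X in (_ <= X)%E]addeC leeD2r//.
have mX := measurable_mixture.
have ieta2 : 0 <= (2 * eta)^-1 by rewrite invr_ge0 mulr_ge0// ltW.
have eta2 : 0 <= eta / 2 by rewrite divr_ge0// ltW.
pose S w := q * (q * \sum_(i in D) \sum_(j in D) Num.max 0 (overlap i j) *
  (trunc_likelihood i w * trunc_likelihood j w)).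
have S0 w : 0 <= S w.
  rewrite /S !mulr_ge0 ?card_inv_ge0// sumr_ge0// => i _; rewrite sumr_ge0// => j _.
  rewrite mulr_ge0 ?le_max ?lexx//.
  by apply: mulr_ge0; exact: trunc_likelihood_ge0.
have mS : measurable_fun [set: tensor R d n] S.
  by do 2 apply: measurable_funM => //; exact: measurable_double_trunc.
apply: (@le_trans _ _ (\int[G]_w (mixture w + eta / 2 + (2 * eta)^-1 * S w)%:E)%E).
  apply: le_integral_EFin.
  - apply: measurable_funM => //; apply: (measurable_sum_trunc
      (g := fun i w => 1 + clamp (f (x i, symmetrize w)))) => i.
    apply: (measurableT_comp (f := fun t => 1 + clamp (f (x i, t)))).
      exact: (measurableT_comp mc (pair1_measurable (x i))).
    exact: measurable_symmetrize.
  - apply: measurable_funD; first exact: measurable_funD.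
    exact: measurable_funM.
  - move=> w; rewrite mulr_ge0 ?card_inv_ge0// sumr_ge0// => i _.
    by rewrite mulr_ge0 ?trunc_likelihood_ge0 ?clamp_ge.
  move=> w; set y := xhat (symmetrize w).
  (* The unnormalised posterior mean of the spike tensor, with truncated likelihoods. *)
  pose F : tensor R d n :=
    [tuple q * \sum_(i in D) trunc_likelihood i w * tnth (h i) k | k < _].
  have FE z : dotp F z = q * \sum_(i in D) trunc_likelihood i w * dotp (h i) z.
    rewrite /dotp big_distrr/=.
    under eq_bigr => k _.
      rewrite tnth_mktuple -mulrA big_distrl/= big_distrr/=.
      over.
    rewrite exchange_big/=; apply: eq_bigr => i _; rewrite mulrA big_distrr/=.
    by apply: eq_bigr => k _; rewrite !mulrA.
  have -> : q * \sum_(i in D) (1 + clamp (f (x i, symmetrize w))) *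
      trunc_likelihood i w = mixture w + dotp F (rank1 d y).
    rewrite FE -mulrDr -big_split/=; congr (_ * _); apply: eq_bigr => i iD.
    rewrite clampE ?f1// mulrDl mul1r; congr (_ + _).
    by rewrite mulrC dotp_rank1.
  have FS : dotp F F <= S w.
    rewrite FE /S ler_wpM2l ?card_inv_ge0//.
    rewrite big_distrr/=; apply: ler_sum => i iD.
    rewrite dotpC FE mulrCA ler_wpM2l ?card_inv_ge0// big_distrr/=.
    apply: ler_sum => j jD; rewrite mulrA [leRHS]mulrC.
    rewrite ler_wpM2l//.
      by apply: mulr_ge0; exact: trunc_likelihood_ge0.
    (* Negative overlaps are replaced by 0, since the pair integrals are only bounded from above. *)
    by rewrite dotp_rank1 dotpC le_max lexx orbT.
  have := @dotp_CS R _ F (rank1 d y) eta^-1.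
  rewrite invr_gt0 invrK => /(_ eta0); rewrite dotp_rank1 xh1 expr1n mul1r => CS.
  have h1 : eta^-1 * dotp F F <= eta^-1 * S w by rewrite ler_pM2l// invr_gt0.
  by rewrite invfM; lra.
rewrite integral_EFinD; last 4 first.
- exact: measurable_funD.
- exact: measurable_funM.
- by move=> w; rewrite addr_ge0// mixture_ge0.
- by move=> w; rewrite mulr_ge0.
rewrite integral_EFinD//; last exact: mixture_ge0.
rewrite integral_cst//= probability_setT mule1 (integral_EFinZl G mS)//.
rewrite [(eta / 2 + M' / _)%:E]EFinD [X in (X <= _)%E]addeC.
rewrite [X in (_ <= X)%E]addeAC [X in (_ <= X)%E]addeC leeD//; last first.
  by rewrite [X in (X <= _)%E]addeC leeD2l//; exact: integral_mixture_le1.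
rewrite [(M' / _)%:E]EFinM muleC lee_wpmul2r ?lee_fin//.
by apply: integral_weighted_second_moment => s; rewrite le_max lexx.
Qed.

End spiked_model.

(** * Overlaps of sparse sign vectors *)

Section signs.
Variable R : realType.

Lemma expR_sub1_le (x : R) : x < 1 -> expR x <= (1 - x)^-1.
Proof.
move=> x1; rewrite -[x in expR x]opprK expRN lef_pV2 ?posrE ?expR_gt0 ?subr_gt0//.
exact: expR_ge1Dx.
Qed.

(* The constant [3 / 2], instead of [1 / 2], only affects [lower_constant]. *)
Lemma cosh_le_gauss (x : R) : expR x + expR (- x) <= 2 * expR (3 / 2 * x ^+ 2).
Proof.
wlog x0 : x / 0 <= x => [hw|].
  have [/hw//|/ltW x0] := leP 0 x.
  by rewrite -sqrrN -[x in expR x + _]opprK addrC hw// oppr_ge0.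
have [x1|x1] := ltP x 1; last first.
  rewrite mulr_natl mulr2n lerD// ler_expR.
    by rewrite expr2 mulrA ler_peMl// ; nra.
  by rewrite (@le_trans _ _ 0) ?oppr_le0// mulr_ge0// sqr_ge0.
(* The bounds [h1] and [h2] add up to [2 + 3 x^2 = 2 (1 + 3/2 x^2)], the origin of [3 / 2]. *)
have h1 : expR (- x) <= 1 - x + x ^+ 2.
  apply: le_trans (expR_sub1_le _) _; first by lra.
  rewrite opprK -[leLHS]mul1r ler_pdivrMr; last by lra.
  rewrite -subr_ge0 (_ : _ - 1 = x ^+ 3); last by ring.
  by rewrite exprn_ge0.
have h2 : expR x <= 1 + x + 2 * x ^+ 2.
  have -> : expR x = expR (x / 2) ^+ 2 by rewrite -expRM_natl; congr expR; field.
  have h : expR (x / 2) ^+ 2 <= ((1 - x / 2)^-1) ^+ 2.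
    by rewrite ler_sqr ?nnegrE ?expR_ge0 ?invr_ge0// ?expR_sub1_le//; lra.
  apply: le_trans h _; rewrite exprVn -[leLHS]mul1r ler_pdivrMr; last first.
    by rewrite exprn_gt0//; lra.
  rewrite -subr_ge0.
  have -> : (1 + x + 2 * x ^+ 2) * (1 - x / 2) ^+ 2 - 1 =
    x ^+ 2 * ((1 - x) * (5 / 4 - x / 2)) by field.
  by rewrite mulr_ge0 ?sqr_ge0// mulr_ge0//; lra.
have := expR_ge1Dx (3 / 2 * x ^+ 2); lra.
Qed.

Definition sgn_sum n (J : {set 'I_n}) (e f : {ffun 'I_n -> bool}) : R :=
  \sum_(i in J) (-1) ^+ e i * (-1) ^+ f i.

(** Only [f] is averaged: for fixed [e] the sign products on [J] are still independent, so the sum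
    factorises over the coordinates. *)
Lemma sgn_sum_mgf n (J : {set 'I_n}) e (theta : R) :
  \sum_(f : {ffun 'I_n -> bool}) expR (theta * sgn_sum J e f) <=
  2 ^+ n * expR (3 / 2 * theta ^+ 2 * #|J|%:R).
Proof.
pose F (i : 'I_n) (b : bool) : R :=
  if i \in J then expR (theta * ((-1) ^+ e i * (-1) ^+ b)) else 1.
have -> : \sum_(f : {ffun 'I_n -> bool}) expR (theta * sgn_sum J e f) =
    \prod_(i < n) \sum_(b : bool) F i b.
  rewrite bigA_distr_bigA/=; apply: eq_bigr => f _.
  rewrite /sgn_sum big_distrr/= expR_sum big_mkcond/=.
  by [].
have F2 i : \sum_b F i b <=
    2 * (if i \in J then expR (3 / 2 * theta ^+ 2) else 1).
  rewrite big_bool /F; case: (i \in J); last by rewrite /= mulr1 -mulr2n.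
  case: (e i); rewrite /= ?expr1 ?expr0 ?mulrNN ?mulr1 ?mul1r ?mulrN1.
    exact: cosh_le_gauss.
  by rewrite addrC; exact: cosh_le_gauss.
apply: (@le_trans _ _ (\prod_(i < n)
    (2 * (if i \in J then expR (3 / 2 * theta ^+ 2) else 1)))).
  apply: ler_prod => i _; rewrite F2 andbT; apply: sumr_ge0 => b _.
  by rewrite /F; case: ifP => _; rewrite ?expR_ge0.
rewrite big_split/= prodr_const card_ord -big_mkcond/= prodr_const.
by rewrite -expRM_natl [#|J|%:R * _]mulrC.
Qed.

Lemma sum_expRN_le2 Q : \sum_(q < Q) expR (- q%:R) <= 2 :> R.
Proof.
have e2 : expR (- 1 : R) <= 2^-1.
  by rewrite expRN lef_pV2 ?posrE ?expR_gt0// (le_trans _ (expR_ge1Dx 1)).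
(* The remainder of the geometric series strengthens the claim for induction. *)
suff : \sum_(q < Q) expR (- q%:R) <= 2 - 2 * expR (- Q%:R) :> R.
  by move=> h; apply: le_trans h _; have := expR_ge0 (- Q%:R : R); lra.
elim: Q => [|Q IH]; first by rewrite big_ord0 oppr0 expR0; lra.
rewrite big_ord_recr/= -[Q.+1%:R]natr1 opprD expRD.
have := expR_ge0 (- Q%:R : R); move: IH e2.
by set y := expR (- Q%:R); set z := expR (- 1); nra.
Qed.

(* Each level set [q <= b G^2 < q + 1] is controlled by the exponential moments
   of order [+- 4 sqrt(b q)]. *)
Lemma sgn_sum_sqr_mgf n (J : {set 'I_n}) e (b : R) :
  0 <= b -> 12 * b * #|J|%:R <= 1 ->
  \sum_(f : {ffun 'I_n -> bool}) expR (b * sgn_sum J e f ^+ 2) <=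
  4 * expR 1 * 2 ^+ n.
Proof.
move=> b0 bJ.
pose lvl (f : {ffun 'I_n -> bool}) := Num.truncn (b * sgn_sum J e f ^+ 2).
pose Q := (\max_f lvl f).+1.
pose th q : R := 4 * Num.sqrt (b * q%:R).
have lvlP f : (lvl f)%:R <= b * sgn_sum J e f ^+ 2 < (lvl f).+1%:R.
  by apply: truncn_itv; rewrite mulr_ge0// sqr_ge0.
(* On level [q], with [G] the sign sum, [th q * |G| >= 4 q]; hence [expR (b G^2) <= expR (q + 1) <=
   expR (1 - 3 q) * expR (th q * |G|)]. The two exponentials cover both signs of [G]. *)
pose T q f : R := expR (1 - 3 * q%:R) *
  (expR (th q * sgn_sum J e f) + expR (- th q * sgn_sum J e f)).
have T0 q f : 0 <= T q f.
  by rewrite mulr_ge0 ?expR_ge0// addr_ge0 ?expR_ge0.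
have pt f : expR (b * sgn_sum J e f ^+ 2) <= \sum_(q < Q) T q f.
  have lQ : (lvl f < Q)%N by rewrite ltnS leq_bigmax.
  rewrite (bigD1 (Ordinal lQ))//= -[leLHS]addr0 lerD//; last first.
    by apply: sumr_ge0 => q _; exact: T0.
  have /andP[l1 l2] := lvlP f.
  apply: (@le_trans _ _ (expR (1 - 3 * (lvl f)%:R) *
      expR (th (lvl f) * `|sgn_sum J e f|))); last first.
    rewrite /T ler_wpM2l ?expR_ge0//.
    have [g0|g0] := ger0P (sgn_sum J e f).
      by rewrite lerDl expR_ge0.
    by rewrite mulrN mulNr lerDr expR_ge0.
  rewrite -expRD ler_expR.
  have h : 4 * (lvl f)%:R <= th (lvl f) * `|sgn_sum J e f|.
    rewrite /th -mulrA ler_wpM2l//.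
    rewrite -sqrtr_sqr -sqrtrM ?mulr_ge0// -[leLHS]ger0_norm// -sqrtr_sqr.
    rewrite ler_wsqrtr// expr2 -mulrA mulrCA ler_wpM2l//.
  by move: l2; rewrite -natr1; lra.
apply: (@le_trans _ _ (\sum_(q < Q) \sum_f T q f)).
  by rewrite exchange_big/=; apply: ler_sum.
apply: (@le_trans _ _ (\sum_(q < Q) 2 * expR 1 * 2 ^+ n * expR (- q%:R))).
  apply: ler_sum => q _; rewrite -big_distrr/= big_split/=.
  have bq : 0 <= b * q%:R by rewrite mulr_ge0.
  have th2 : th q ^+ 2 = 16 * (b * q%:R).
    by rewrite exprMn sqr_sqrtr// -natrX.
  have m1 := sgn_sum_mgf J e (th q); have m2 := sgn_sum_mgf J e (- th q).
  rewrite sqrrN in m2.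
  (* [3 / 2 * 16 = 2 * 12], the origin of the factor 12; a decay [expR (- q)] remains after
     multiplication by [expR (1 - 3 q)]. *)
  have le2 : 3 / 2 * th q ^+ 2 * #|J|%:R <= 2 * q%:R.
    rewrite th2 (_ : _ * #|J|%:R = 2 * q%:R * (12 * b * #|J|%:R)); last by field.
    by rewrite ler_piMr// mulr_ge0.
  have m3 : 2 ^+ n * expR (3 / 2 * th q ^+ 2 * #|J|%:R) <=
      2 ^+ n * expR (2 * q%:R) :> R.
    by rewrite ler_wpM2l ?exprn_ge0// ler_expR.
  apply: (@le_trans _ _ (expR (1 - 3 * q%:R) * (2 * (2 ^+ n * expR (2 * q%:R))))).
    rewrite ler_wpM2l ?expR_ge0//.
    by move: (2 ^+ n * expR (3 / 2 * _ * _)) m1 m2 m3 => *; lra.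
  have E : expR (1 - 3 * q%:R) * expR (2 * q%:R) = expR 1 * expR (- q%:R) :> R.
    by rewrite -!expRD; congr expR; ring.
  have -> : expR (1 - 3 * q%:R) * (2 * (2 ^+ n * expR (2 * q%:R))) =
    2 * 2 ^+ n * (expR (1 - 3 * q%:R) * expR (2 * q%:R)) :> R by ring.
  rewrite E (_ : _ * (expR 1 * _) = 2 * expR 1 * 2 ^+ n * expR (- q%:R))//.
  by ring.
rewrite -big_distrr/= (_ : 4 * expR 1 * 2 ^+ n = 2 * expR 1 * 2 ^+ n * 2);
  last by ring.
by rewrite ler_wpM2l ?sum_expRN_le2// mulr_ge0 ?exprn_ge0// mulr_ge0 ?expR_ge0.
Qed.

End signs.

Section hypergeometric.

Lemma card_supersets_le n (J : {set 'I_n}) k :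
  (#|[set S : {set 'I_n} | (J \subset S) && (#|S| == k)]%SET| <=
   'C(n - #|J|, k - #|J|))%N.
Proof.
have -> : (n - #|J| = #|~: J|)%N by rewrite [in RHS]cardsCs finset.setCK card_ord.
rewrite -cards_draws.
pose X := [set S : {set 'I_n} | (J \subset S) && (#|S| == k)]%SET.
have inj : {in X &, injective (fun S => S :\: J)%SET}.
  move=> S S'; rewrite !inE => /andP[JS _] /andP[JS' _] /= e.
  have sE (A : {set 'I_n}) : (J \subset A -> A = J :|: (A :\: J))%SET.
    move=> JA; rewrite -{1}(finset.setID A J) finset.setIC.
    by rewrite (finset.setIidPl JA).
  by rewrite (sE S)// e -sE.
rewrite -(card_in_imset inj).
apply/subset_leq_card/fintype.subsetP => A /imsetP[S].
rewrite !inE => /andP[JS /eqP Sk] ->; apply/andP; split.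
  by rewrite finset.setDE finset.subsetIr.
by rewrite cardsD (finset.setIidPr JS) Sk.
Qed.

(** The quotient of the two binomials is a product of factors [(k - i) / (n - i)], [i < j], each at
    most [k / n]; the claim is this bound without division. *)
Lemma bin_ratio_le n k j : (j <= k <= n)%N ->
  ('C(n - j, k - j) * n ^ j <= 'C(n, k) * k ^ j)%N.
Proof.
elim: j => [|j IH]; first by rewrite !subn0 !expn0.
move=> /andP[jk kn]; have nj : (0 < n - j)%N by rewrite subn_gt0 (leq_trans jk).
rewrite -(leq_pmul2l nj).
have -> : ((n - j) * ('C(n - j.+1, k - j.+1) * n ^ j.+1) =
    (k - j) * n * ('C(n - j, k - j) * n ^ j))%N.
  rewrite expnS mulnA !subnS mul_bin_diag prednK ?subn_gt0//.
  by rewrite -!mulnA; congr (_ * _)%N; rewrite mulnCA.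
apply: (@leq_trans ((k - j) * n * ('C(n, k) * k ^ j)))%N.
  by rewrite leq_mul2l IH ?orbT// kn (ltnW jk).
rewrite expnS [X in (_ <= X)%N](_ : _ = ((n - j) * k * ('C(n, k) * k ^ j)))%N;
  last by rewrite -!mulnA; congr (_ * _)%N; rewrite mulnCA.
by rewrite leq_mul2r; apply/orP; right; rewrite !mulnBl mulnC leq_sub2l// leq_mul2l kn orbT.
Qed.

(** Choose the intersection inside [S], then complete it; forgetting that the completion must avoid
    the rest of [S] only adds sets. *)
Lemma card_inter_le n (S : {set 'I_n}) k j :
  (#|[set S' : {set 'I_n} | (#|S'| == k) && (#|S :&: S'| == j)]%SET| <=
   'C(#|S|, j) * 'C(n - j, k - j))%N.
Proof.
rewrite -sum1_card.
rewrite (partition_big (fun S' => S :&: S')%SET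
  (fun J => (J \subset S) && (#|J| == j)))/=; last first.
  by move=> S'; rewrite !inE => /andP[_ ->]; rewrite finset.subsetIl.
rewrite -cards_draws -sum_nat_cond_const.
apply: leq_sum => J /andP[JS /eqP Jj]; rewrite sum1dep_card -Jj.
apply: leq_trans (card_supersets_le J k); apply/subset_leq_card.
apply/fintype.subsetP => S'; rewrite !inE => /andP[/andP[-> _] /eqP <-].
by rewrite finset.subsetIr.
Qed.

End hypergeometric.

Section binomial_bounds.
Variable R : realType.

(** Weak Stirling bound; the induction step is [(1 + 1/j)^j <= e]. *)
Lemma natrX_le_fact j : (j%:R ^+ j <= expR 1 ^+ j * j`!%:R :> R).
Proof.
elim: j => [|j IH]; first by rewrite !expr0 mulr1.
have [->|j0] := posnP j; first by rewrite !expr1 mulr1 -[leLHS]expR0 ler_expR.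
have jR : 0 < j%:R :> R by rewrite ltr0n.
have h : j.+1%:R ^+ j <= expR 1 * j%:R ^+ j :> R.
  have -> : expR 1 = expR (j%:R^-1) ^+ j :> R.
    by rewrite -expRM_natl mulfV// gt_eqF.
  rewrite -exprMn lerXn2r ?nnegrE ?mulr_ge0 ?expR_ge0//.
  apply: le_trans (ler_wpM2r (ltW jR) (expR_ge1Dx _)).
  by rewrite mulrDl mul1r mulVf ?gt_eqF// natr1.
rewrite exprS factS natrM.
apply: (@le_trans _ _ (j.+1%:R * (expR 1 * (expR 1 ^+ j * j`!%:R)))).
  by rewrite ler_wpM2l// (le_trans h)// ler_wpM2l ?expR_ge0.
have -> : j.+1%:R * (expR 1 * (expR 1 ^+ j * j`!%:R)) =
    expR 1 * expR 1 ^+ j * (j.+1%:R * j`!%:R) :> R by ring.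
by rewrite -exprS.
Qed.

Lemma bin_le_expR k j : (0 < j)%N ->
  'C(k, j)%:R <= (expR 1 * (k%:R / j%:R)) ^+ j :> R.
Proof.
move=> j0; have jR : 0 < j%:R :> R by rewrite ltr0n.
have fR : 0 < j`!%:R :> R by rewrite ltr0n fact_gt0.
have h : 'C(k, j)%:R * j`!%:R <= k%:R ^+ j :> R.
  rewrite -natrM bin_ffact -natrX ler_nat.
  elim: (j) => [|i IH]; first by rewrite ffactn0 expn0.
  by rewrite ffactnSr expnSr leq_mul// leq_subr.
rewrite -(ler_pM2r fR) (le_trans h)// -(ler_pM2r (exprn_gt0 j jR)).
rewrite exprMn expr_div_n.
have -> : expR 1 ^+ j * (k%:R ^+ j / j%:R ^+ j) * j`!%:R * j%:R ^+ j =
    k%:R ^+ j * (expR 1 ^+ j * j`!%:R) :> R.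
  by field; rewrite expf_neq0// gt_eqF.
by rewrite ler_wpM2l ?exprn_ge0// natrX_le_fact.
Qed.
End binomial_bounds.

Section overlap_average.
Variable R : realType.

(** The second-moment exponent per support element for [d = 2], when the lambda term is at its limit
    [4 * rho * beta]. It dominates the larger [d] because [|t| <= 1]. *)
Definition overlap_rate (beta t : R) : R := 2 * beta * (t ^+ 2 / (1 + t ^+ 2)).

(* The exponent is the slack in [2 tau^2 / (1 + tau^2) <= tau], which absorbs the
   factor [1 / tau] of the entropy bound on ['C(k, tau k)]. *)
Lemma overlap_fraction_bound (beta tau : R) : 0 < beta -> 0 < tau <= 1 ->
  1 < 96 * beta * tau ->
  expR (- (beta * ((1 - tau) ^+ 2 / (1 + tau ^+ 2)))) <= 480 * tau.
Proof.
move=> b0 /andP[t0 t1] bt.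
have q0 : 0 < 1 + tau ^+ 2 by rewrite ltr_pwDl// sqr_ge0.
have [t2|t2] := leP (1 / 2) tau.
  apply: (@le_trans _ _ 1); last by lra.
  by rewrite -[leRHS]expR0 ler_expR oppr_le0 mulr_ge0 ?divr_ge0 ?sqr_ge0// ltW.
(* For [tau <= 1 / 2] the fraction is at least [1 / 5]. Then [expR (- (beta / 5)) <= 5 / beta < 5 *
   96 * tau], the origin of 480. *)
apply: (@le_trans _ _ (expR (- (beta / 5)))).
  rewrite ler_expR lerN2 ler_wpM2l ?(ltW b0)//.
  rewrite -(ler_pM2r q0) divfK ?gt_eqF//; nra.
have b5 : 0 < beta / 5 by rewrite divr_gt0.
apply: (@le_trans _ _ (beta / 5)^-1).
  rewrite expRN lef_pV2 ?posrE ?expR_gt0//.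
  by have := expR_ge1Dx (beta / 5); lra.
rewrite -(ler_pM2r b5) mulVf ?gt_eqF//; nra.
Qed.

(** Both sides are [j]-th powers. In the base, [expR (- beta)] from [rho] and [expR y] combine to
    the exponential of [overlap_fraction_bound], which beats [1 / tau]; the [expR (- 3)] pays for
    the [e] of the binomial bound and leaves [expR (- 2)]. *)
Lemma hypergeometric_term_le k j (beta rho : R) : 0 < beta -> 0 <= rho ->
  rho <= expR (- beta) * (expR (- 3) / 480) -> (0 < j <= k)%N ->
  k%:R < 96 * beta * j%:R ->
  'C(k, j)%:R * rho ^+ j * expR (k%:R * overlap_rate beta (j%:R / k%:R)) <=
  expR (- 2 * j%:R).
Proof.
move=> b0 r0 rb /andP[j0 jk] kj; rewrite /overlap_rate.
have jR : 0 < j%:R :> R by rewrite ltr0n.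
have kR : 0 < k%:R :> R by rewrite ltr0n (leq_trans j0).
set tau := j%:R / k%:R.
have t0 : 0 < tau by rewrite divr_gt0.
have t1 : tau <= 1 by rewrite ler_pdivrMr// mul1r ler_nat.
have q0 : 0 < 1 + tau ^+ 2 by rewrite ltr_pwDl// sqr_ge0.
have bt : 1 < 96 * beta * tau by rewrite /tau mulrA ltr_pdivlMr// mul1r.
pose y := beta * (2 * tau / (1 + tau ^+ 2)).
have -> : k%:R * (2 * beta * (tau ^+ 2 / (1 + tau ^+ 2))) = j%:R * y.
  have -> : j%:R = k%:R * tau by rewrite /tau mulrCA mulfV ?mulr1// gt_eqF.
  by rewrite /y; field; rewrite gt_eqF.
rewrite [- 2 * j%:R]mulrC !expRM_natl.
apply: (@le_trans _ _ ((expR 1 * (k%:R / j%:R)) ^+ j * rho ^+ j * expR y ^+ j)).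
  by rewrite ler_wpM2r ?exprn_ge0 ?expR_ge0// ler_wpM2r ?exprn_ge0 ?bin_le_expR.
rewrite -!exprMn lerXn2r ?nnegrE ?expR_ge0//.
  by rewrite !mulr_ge0 ?expR_ge0// ?invr_ge0 ltW.
have -> : k%:R / j%:R = tau^-1 by rewrite /tau invf_div.
apply: (@le_trans _ _ (expR 1 * tau^-1 * (expR (- beta) * (expR (- 3) / 480)) * expR y)).
  rewrite ler_wpM2r ?expR_ge0// ler_wpM2l//.
  by rewrite mulr_ge0 ?expR_ge0// invr_ge0 ltW.
have -> : expR 1 * tau^-1 * (expR (- beta) * (expR (- 3) / 480)) * expR y =
    expR (-2) * (expR (- (beta * ((1 - tau) ^+ 2 / (1 + tau ^+ 2)))) / (480 * tau)).
  have e1 : expR 1 * expR (- 3) = expR (- 2) :> R by rewrite -expRD; congr expR; ring.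
  have e2 : expR (- beta) * expR y =
      expR (- (beta * ((1 - tau) ^+ 2 / (1 + tau ^+ 2)))).
    by rewrite -expRD; congr expR; rewrite /y; field; rewrite gt_eqF.
  by rewrite -e1 -e2; field; rewrite gt_eqF.
have t480 : 0 < 480 * tau by lra.
apply: ler_piMr; first exact: expR_ge0.
rewrite (ler_pdivrMr _ _ t480) mul1r.
by apply: overlap_fraction_bound => //; rewrite t0 t1.
Qed.

Lemma sgn_sum_le n (J : {set 'I_n}) e f : `|sgn_sum R J e f| <= #|J|%:R.
Proof.
apply: le_trans (ler_norm_sum _ _ _) _.
rewrite -sum1_card natr_sum; apply: ler_sum => i _.
by rewrite normrM !normrX normrN1 !expr1n mulr1.
Qed.

Section average.
Variables (n k : nat) (rho : R).
Hypotheses (hk : rho * n%:R = k%:R) (k0 : (0 < k)%N) (r1 : rho <= 1).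

(** Since signs are kept off the support too, the set is a product and averages split into one over
    supports and one over signs. *)
Definition sparse_signs : {set {set 'I_n} * {ffun 'I_n -> bool}} :=
  [set p : {set 'I_n} * {ffun 'I_n -> bool} | #|p.1|%:R == rho * n%:R]%SET.
Local Notation D := sparse_signs.
Implicit Types (p : {set 'I_n} * {ffun 'I_n -> bool}) (S : {set 'I_n}).

Lemma mem_sparse_signs p : (p \in D) = (#|p.1| == k).
Proof. by rewrite inE hk eqr_nat. Qed.

Lemma sum_sparse_signs (V : nmodType) (F : {set 'I_n} -> {ffun 'I_n -> bool} -> V) :
  \sum_(p in D) F p.1 p.2 = \sum_(S : {set 'I_n} | #|S| == k) \sum_e F S e.
Proof.
rewrite pair_big_dep/=; apply: eq_bigl => p.
by rewrite mem_sparse_signs andbT.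
Qed.

Lemma card_sparse_signs : #|D| = ('C(n, k) * 2 ^ n)%N.
Proof.
rewrite -sum1_card (sum_sparse_signs (fun _ _ => 1%N)).
under eq_bigr do rewrite sum1_card card_ffun card_bool card_ord.
by rewrite sum_nat_cond_const card_draws card_ord.
Qed.

Lemma k_le_n : (k <= n)%N.
Proof. by rewrite -(ler_nat R) -hk ler_piMl. Qed.

Lemma n_gt0_of_k : (0 < n)%N. Proof. exact: leq_trans k0 k_le_n. Qed.

Lemma card_sparse_signs_gt0 : (0 < #|D|)%N.
Proof. by rewrite card_sparse_signs muln_gt0 bin_gt0 k_le_n expn_gt0. Qed.

Lemma dotp_sprade_vector p p' :
  dotp (sprade_vector rho p) (sprade_vector rho p') =
  sgn_sum R (p.1 :&: p'.1) p.2 p'.2 / k%:R.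
Proof.
rewrite /dotp /sgn_sum big_distrl/= [RHS]big_mkcond/=; apply: eq_bigr => i _.
rewrite !tnth_mktuple finset.in_setI.
case: (i \in p.1); last by rewrite mul0r.
case: (i \in p'.1); last by rewrite mulr0.
by rewrite /= mulrACA -invfM -expr2 hk sqr_sqrtr.
Qed.

Lemma dotp_sprade_vector_unit p : p \in D ->
  dotp (sprade_vector rho p) (sprade_vector rho p) = 1.
Proof.
rewrite mem_sparse_signs => /eqP pk; rewrite dotp_sprade_vector finset.setIid.
rewrite /sgn_sum (eq_bigr (fun=> 1)).
  by rewrite sumr_const pk divff// gt_eqF// ltr0n.
by move=> i _; rewrite -expr2 sqrr_sign.
Qed.

Lemma hypergeometric_le S j : #|S| = k -> (j <= k)%N ->
  #|[set S' : {set 'I_n} | (#|S'| == k) && (#|S :&: S'| == j)]%SET|%:R <=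
  'C(k, j)%:R * rho ^+ j * 'C(n, k)%:R :> R.
Proof.
move=> Sk jk; have n0 := n_gt0_of_k.
have nR : 0 < n%:R ^+ j :> R by rewrite exprn_gt0// ltr0n.
apply: (@le_trans _ _ ('C(k, j) * 'C(n - j, k - j))%:R).
  by rewrite ler_nat -Sk card_inter_le.
rewrite natrM -mulrA ler_wpM2l// -(ler_pM2r nR) mulrAC -exprMn hk.
rewrite -!natrX -!natrM ler_nat [X in (_ <= X)%N]mulnC.
by apply: bin_ratio_le; rewrite jk k_le_n.
Qed.

Variable beta : R.
Hypotheses (b0 : 0 < beta) (r0 : 0 <= rho).
Hypothesis rb : rho <= expR (- beta) * (expR (- 3) / 480).

(** [96 = 12 * 8]: exactly the condition of [sgn_sum_sqr_mgf] for [b = 8 * beta / k]. *)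
Definition small_inter (p p' : {set 'I_n} * {ffun 'I_n -> bool}) : bool :=
  96 * beta * #|p.1 :&: p'.1|%:R <= k%:R.

Local Notation t p p' := (dotp (sprade_vector rho p) (sprade_vector rho p')).

(** The sign average is bounded for each support separately. The exponent is four times the bound
    [2 k beta t^2] on the second-moment exponent; the margin is spent in [second_moment_to1]. *)
Lemma sum_small_inter p : \sum_(p' in D | small_inter p p')
  expR (8 * beta * k%:R * t p p' ^+ 2) <= 4 * expR 1 * #|D|%:R.
Proof.
have kR : 0 < k%:R :> R by rewrite ltr0n.
rewrite big_mkcondr/= (eq_bigr (fun p' => if small_inter p (p'.1, p'.2) then
   expR (8 * beta / k%:R * sgn_sum R (p.1 :&: p'.1) p.2 p'.2 ^+ 2) else 0)).
  rewrite (sum_sparse_signs (fun S' e' => if small_inter p (S', e') then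
   expR (8 * beta / k%:R * sgn_sum R (p.1 :&: S') p.2 e' ^+ 2) else 0)).
  apply: (@le_trans _ _ (\sum_(S : {set 'I_n} | #|S| == k) 4 * expR 1 * 2 ^+ n)).
    apply: ler_sum => S _; rewrite /small_inter/=.
    have [mS|mS] := boolP (96 * beta * #|p.1 :&: S|%:R <= k%:R); last first.
      by rewrite big1// !mulr_ge0 ?expR_ge0// exprn_ge0.
    apply: sgn_sum_sqr_mgf; first by rewrite mulr_ge0 ?invr_ge0 ?mulr_ge0// ltW.
    rewrite -(ler_pM2r kR) mul1r (le_trans _ mS)//.
    rewrite le_eqVlt; apply/orP; left; apply/eqP; field.
    by rewrite gt_eqF.
  rewrite sumr_const -[_ *+ _]mulr_natr card_sparse_signs natrM natrX.
  rewrite (_ : #|_| = 'C(n, k)); first by rewrite ['C(n, k)%:R * _]mulrC !mulrA.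
  by rewrite -cardsE card_draws card_ord.
move=> p' _; rewrite dotp_sprade_vector; case: p' => S' e' /=; case: ifP => // _.
by congr expR; field; rewrite gt_eqF.
Qed.

Lemma overlap_rate_le (u v : R) : `|u| <= v ->
  overlap_rate beta u <= overlap_rate beta v.
Proof.
move=> uv; have v0 : 0 <= v by exact: le_trans uv.
have uv2 : u ^+ 2 <= v ^+ 2.
  by rewrite -(real_normK (num_real u)) ler_sqr ?nnegrE.
have hu : 0 < 1 + u ^+ 2 by rewrite ltr_pwDl// sqr_ge0.
have hv : 0 < 1 + v ^+ 2 by rewrite ltr_pwDl// sqr_ge0.
rewrite ler_wpM2l// ?mulr_ge0 ?(ltW b0)//.
by rewrite ler_pdivrMr// mulrAC ler_pdivlMr//; nra.
Qed.

(** Here the signs are bounded trivially by [|t| <= j / k], and the rarity of large intersections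
    does all the work. *)
Lemma sum_large_inter p : p \in D -> \sum_(p' in D | ~~ small_inter p p')
  expR (k%:R * overlap_rate beta (t p p')) <=
  2 * expR (- (k%:R / (96 * beta))) * #|D|%:R.
Proof.
rewrite mem_sparse_signs => /eqP pk.
have kR : 0 < k%:R :> R by rewrite ltr0n.
have b96 : 0 < 96 * beta by rewrite mulr_gt0.
pose v j : R := if 96 * beta * j%:R <= k%:R then 0 else
  expR (k%:R * overlap_rate beta (j%:R / k%:R)).
have v0 j : 0 <= v j by rewrite /v; case: ifP => // _; exact: expR_ge0.
rewrite big_mkcondr/=.
apply: (@le_trans _ _ (\sum_(p' in D) v #|p.1 :&: p'.1|)).
  apply: ler_sum => p' _; rewrite /v /small_inter.
  case: (96 * beta * _ <= _) => //=; rewrite ler_expR ler_wpM2l// overlap_rate_le//.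
  rewrite dotp_sprade_vector normrM [`|_^-1|]ger0_norm ?invr_ge0// ler_wpM2r ?invr_ge0//.
  exact: sgn_sum_le.
rewrite (sum_sparse_signs (fun S' _ => v #|p.1 :&: S'|)).
under eq_bigr do rewrite sumr_const card_ffun card_bool card_ord.
pose pos j : 'I_k.+1 := inord j.
rewrite (partition_big (fun S' : {set 'I_n} => pos #|p.1 :&: S'|) xpredT)//=.
rewrite card_sparse_signs natrM mulrA.
apply: (@le_trans _ _ (\sum_(j < k.+1)
    (expR (- j%:R) * (expR (- (k%:R / (96 * beta))) * 'C(n, k)%:R * (2 ^ n)%:R)))).
  apply: ler_sum => j _.
  rewrite (eq_bigr (fun=> v j *+ 2 ^ n)); last first.
    move=> S' /andP[_ /eqP <-]; rewrite /pos inordK// ltnS -pk.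
    exact/subset_leq_card/finset.subsetIl.
  rewrite sumrMnl -[_ *+ 2 ^ n]mulr_natr !mulrA ler_wpM2r//.
  rewrite sumr_const -[v j *+ _]mulr_natr /v.
  case: ifPn => jk; first by rewrite mul0r !mulr_ge0 ?expR_ge0.
  rewrite -ltNge in jk.
  have j0 : (0 < j)%N.
    by rewrite lt0n; apply/eqP => j0; move: jk; rewrite j0 mulr0 ltNge ltW.
  have jk' : (j <= k)%N by rewrite -ltnS.
  apply: (@le_trans _ _ (expR (k%:R * overlap_rate beta (j%:R / k%:R)) *
      ('C(k, j)%:R * rho ^+ j * 'C(n, k)%:R))).
    rewrite ler_wpM2l ?expR_ge0//; apply: le_trans (hypergeometric_le pk jk').
    rewrite ler_nat; apply/subset_leq_card/fintype.subsetP => S'.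
    rewrite !inE unfold_in/= => /andP[-> /eqP <-]; rewrite /pos inordK//.
      by rewrite eqxx.
    by rewrite ltnS -pk; exact/subset_leq_card/finset.subsetIl.
  rewrite mulrA ler_wpM2r// mulrC -expRD.
  apply: le_trans (hypergeometric_term_le b0 r0 rb _ jk) _; first by rewrite j0.
  (* One factor [expR (- j)] makes the sum over [j] converge; the other gives the decay in [k],
     because [j > k / (96 beta)]. *)
  rewrite ler_expR (_ : - 2 * j%:R = - j%:R - j%:R); last by ring.
  by rewrite lerD2l lerN2 ler_pdivrMr// mulrC ltW.
rewrite -big_distrl/= [leRHS](_ : _ = 2 * (expR (- (k%:R / (96 * beta))) *
  'C(n, k)%:R * (2 ^ n)%:R)); last by ring.
by rewrite ler_wpM2r ?sum_expRN_le2// !mulr_ge0 ?expR_ge0.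
Qed.

End average.
End overlap_average.

Section second_moment_bounds.
Variables (R : realType) (d n k : nat) (rho beta lam del : R).
Hypotheses (hk : rho * n%:R = k%:R) (k0 : (0 < k)%N) (r1 : rho <= 1).
Hypotheses (b0 : 0 < beta) (r0 : 0 <= rho).
Hypothesis rb : rho <= expR (- beta) * (expR (- 3) / 480).
Hypotheses (lam0 : 0 <= lam) (del0 : 0 < del).
Hypothesis lam_lt : lam ^+ 2 + 2 * lam * del <= 4 * rho * beta.
Hypothesis d2 : (2 <= d)%N.

Local Notation D := (sparse_signs n rho).
Local Notation t p p' := (dotp (sprade_vector rho p) (sprade_vector rho p')).
Local Notation q := (#|D|%:R^-1 : R).
Implicit Types (p : {set 'I_n} * {ffun 'I_n -> bool}).

Let kR : 0 < k%:R :> R. Proof. by rewrite ltr0n. Qed.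

Definition large_overlap_tail : R := 2 * expR (- (k%:R / (96 * beta))).
Local Notation tail := large_overlap_tail.

(** Shared by the three bounds below: [(c, a)] is [(0, 1)] for boundedness, and [c = 1] or [c = 0]
    with [a] of order [1 / sqrt (k beta)] for the two limits. *)
Lemma average_overlap_le (F : _ -> _ -> R) (a c : R) : 0 <= a ->
  (forall p p', p \in D -> p' \in D -> F p p' <= c +
    (if small_inter k beta p p' then a * expR (8 * beta * k%:R * t p p' ^+ 2)
     else expR (k%:R * overlap_rate beta (t p p')))) ->
  q * (q * \sum_(p in D) \sum_(p' in D) F p p') <= c + a * (4 * expR 1) + tail.
Proof.
move=> a0 hF.
have D0 : 0 < #|D|%:R :> R by rewrite ltr0n (card_sparse_signs_gt0 hk).
have inner p : p \in D -> \sum_(p' in D) F p p' <=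
    (c + a * (4 * expR 1) + tail) * #|D|%:R.
  move=> pD; apply: (@le_trans _ _ (\sum_(p' in D) (c +
    (if small_inter k beta p p' then a * expR (8 * beta * k%:R * t p p' ^+ 2)
     else expR (k%:R * overlap_rate beta (t p p')))))).
    by apply: ler_sum => p' p'D; exact: hF.
  rewrite big_split/= sumr_const -[c *+ _]mulr_natr (mulrDl (c + _)) (mulrDl c).
  rewrite -addrA lerD2l.
  rewrite (bigID (small_inter k beta p))/=; apply: lerD.
    rewrite (eq_bigr (fun p' => a * expR (8 * beta * k%:R * t p p' ^+ 2))).
      rewrite -big_distrr/= -[leRHS]mulrA ler_wpM2l//.
      exact: (sum_small_inter hk k0 b0 p).
    by move=> p' /andP[_ ->].
  rewrite (eq_bigr (fun p' => expR (k%:R * overlap_rate beta (t p p')))).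
    exact: (sum_large_inter hk k0 r1 b0 r0 rb pD).
  by move=> p' /andP[_ /negbTE ->].
rewrite mulrA -[q * q * _]mulrC -ler_pdivlMr ?mulr_gt0 ?invr_gt0//.
apply: (@le_trans _ _ (\sum_(p in D) (c + a * (4 * expR 1) + tail) * #|D|%:R)).
  exact: ler_sum.
rewrite sumr_const -[_ *+ #|_|]mulr_natr -mulrA ?invfM ?invrK.
by [].
Qed.

Local Notation E p p' := (second_moment_exponent n lam del (t p p' ^+ d)).
Local Notation z p p' := (2 * k%:R * beta * t p p' ^+ 2).

Let t1 p p' : p \in D -> p' \in D -> `|t p p'| <= 1.
Proof.
by move=> pD p'D; apply: dotp_unit_le1; exact: (dotp_sprade_vector_unit hk k0).
Qed.

Let pos_pow_le p p' e : p \in D -> p' \in D -> (e <= d)%N ->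
  Num.max 0 (t p p' ^+ d) <= `|t p p'| ^+ e.
Proof.
move=> pD p'D ed; rewrite ge_max exprn_ge0//=.
apply: le_trans (ler_norm _) _; rewrite normrX.
by apply: ler_wiXn2l => //; exact: t1.
Qed.

Let E_le p p' : E p p' <= 2 * k%:R * beta *
  (Num.max 0 (t p p' ^+ d) / (1 + Num.max 0 (t p p' ^+ d))).
Proof.
have m0 : 0 <= Num.max 0 (t p p' ^+ d) by rewrite le_max lexx.
rewrite /second_moment_exponent ler_wpM2r//.
  by rewrite divr_ge0// addr_ge0.
rewrite -hk.
apply: (@le_trans _ _ (n%:R / 2 * (4 * rho * beta))).
  by rewrite ler_wpM2l// divr_ge0.
by rewrite le_eqVlt; apply/orP; left; apply/eqP; field.
Qed.

Let E_ge0 p p' : 0 <= E p p'.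
Proof.
have m0 : 0 <= Num.max 0 (t p p' ^+ d) by rewrite le_max lexx.
rewrite /second_moment_exponent mulr_ge0//.
  rewrite mulr_ge0 ?divr_ge0// addr_ge0 ?sqr_ge0// mulr_ge0 ?(ltW del0)//.
  by rewrite mulr_ge0.
by rewrite divr_ge0// addr_ge0.
Qed.

Let E_le_rate p p' : p \in D -> p' \in D ->
  E p p' <= k%:R * overlap_rate beta (t p p').
Proof.
move=> pD p'D; apply: le_trans (E_le p p') _; rewrite /overlap_rate.
set m := Num.max _ _.
have m0 : 0 <= m by rewrite le_max lexx.
have mt : m <= t p p' ^+ 2.
  by rewrite -(real_normK (num_real (t p p'))) pos_pow_le.
rewrite (_ : k%:R * _ = 2 * k%:R * beta * (t p p' ^+ 2 / (1 + t p p' ^+ 2)));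
  last by ring.
rewrite ler_wpM2l ?mulr_ge0// ?(ltW b0)//.
have h1 : 0 < 1 + m by rewrite ltr_pwDl.
have h2 : 0 < 1 + t p p' ^+ 2 by rewrite ltr_pwDl// sqr_ge0.
by rewrite ler_pdivrMr// mulrAC ler_pdivlMr//; nra.
Qed.

Let z_ge0 p p' : 0 <= z p p'.
Proof. by rewrite mulr_ge0 ?sqr_ge0// mulr_ge0 ?(ltW b0)// mulr_ge0. Qed.

Let rate_le_z p p' : k%:R * overlap_rate beta (t p p') <= z p p'.
Proof.
rewrite /overlap_rate.
have h2 : 0 < 1 + t p p' ^+ 2 by rewrite ltr_pwDl// sqr_ge0.
rewrite (_ : k%:R * _ = z p p' / (1 + t p p' ^+ 2)); last first.
  by field; rewrite gt_eqF.
by rewrite ler_piMr ?z_ge0// invf_le1// lerDl sqr_ge0.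
Qed.

(* [4 sqrt (k beta) |t| <= 1 + 4 k beta t^2] by AM-GM. *)
Let norm_expR_le p p' : `|t p p'| * expR (2 * z p p') <=
  (4 * Num.sqrt (k%:R * beta))^-1 * expR (8 * beta * k%:R * t p p' ^+ 2).
Proof.
set s := Num.sqrt _.
have s0 : 0 < s by rewrite sqrtr_gt0 mulr_gt0.
have s2 : s ^+ 2 = k%:R * beta by rewrite sqr_sqrtr// mulr_ge0// ltW.
have -> : 8 * beta * k%:R * t p p' ^+ 2 = 2 * z p p' + 2 * z p p' by ring.
rewrite (expRD (2 * z p p') (2 * z p p')) [leRHS]mulrA.
rewrite ler_wpM2r ?expR_ge0// mulrC ler_pdivlMr ?mulr_gt0//.
have := expR_ge1Dx (2 * z p p').
have -> : 2 * z p p' = 4 * s ^+ 2 * `|t p p'| ^+ 2.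
  by rewrite s2 real_normK ?num_real//; ring.
move=> h; apply: le_trans h; rewrite -subr_ge0.
rewrite (_ : _ - _ = (2 * s * `|t p p'| - 1) ^+ 2) ?sqr_ge0//.
by ring.
Qed.

Lemma second_moment_bounded :
  weighted_second_moment d D (@sprade_vector R rho n) lam del (cst 1) <=
  4 * expR 1 + tail.
Proof.
rewrite -[4 * expR 1]mul1r -[1 * _]add0r.
apply: average_overlap_le => // p p' pD p'D; rewrite add0r !mul1r.
case: ifP => _; rewrite ler_expR; last exact: E_le_rate.
apply: le_trans (E_le_rate pD p'D) _; apply: le_trans (rate_le_z _ _) _.
have := z_ge0 p p'; move: (t p p' ^+ 2) => y; nra.
Qed.

Hypothesis d3 : (3 <= d)%N.

(** The factor [|t|] beyond the quadratic [z] is what [d >= 3] provides; through [norm_expR_le] it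
    yields the vanishing factor [1 / sqrt (k beta)]. *)
Let E_le_cube p p' : p \in D -> p' \in D -> E p p' <= `|t p p'| * z p p'.
Proof.
move=> pD p'D; apply: le_trans (E_le p p') _.
rewrite (_ : `|_| * _ = 2 * k%:R * beta * (`|t p p'| ^+ 3)); last first.
  by rewrite [X in _ = _ * X]exprS real_normK ?num_real//; ring.
rewrite ler_wpM2l ?mulr_ge0// ?(ltW b0)//.
apply: le_trans (pos_pow_le pD p'D d3).
set m := Num.max _ _.
have m0 : 0 <= m by rewrite le_max lexx.
by rewrite ler_piMr// invf_le1 ?ltr_pwDl// lerDl.
Qed.

Definition small_overlap_rest : R := expR 1 / Num.sqrt (k%:R * beta).

Let restE :
  (4 * Num.sqrt (k%:R * beta))^-1 * (4 * expR 1) = small_overlap_rest.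
Proof.
rewrite /small_overlap_rest; field; rewrite gt_eqF// sqrtr_gt0 mulr_gt0//.
Qed.

(** For small intersections, [expR E - 1 <= E expR E <= |t| z expR z <= |t| expR (2 z)], and
    [norm_expR_le] raises [2 z] to [4 z]. *)
Lemma second_moment_to1 :
  weighted_second_moment d D (@sprade_vector R rho n) lam del (cst 1) <=
  1 + small_overlap_rest + tail.
Proof.
rewrite -restE; apply: average_overlap_le => [|p p' pD p'D].
  by rewrite invr_ge0 mulr_ge0// sqrtr_ge0.
rewrite mul1r; case: ifP => _; last first.
  rewrite -[leLHS]add0r lerD// ler_expR; exact: E_le_rate.
apply: le_trans (lerD (lexx 1) (norm_expR_le p p')).
have e1 : expR (E p p') <= 1 + E p p' * expR (E p p').
  have := expR_ge1Dx (- E p p'); rewrite -(ler_pM2r (expR_gt0 (E p p'))).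
  by rewrite mulrDl mul1r -expRD addNr expR0 mulNr => h; lra.
apply: le_trans e1 _; rewrite lerD2l.
have Ez : E p p' <= z p p'.
  by apply: le_trans (E_le_rate pD p'D) _; exact: rate_le_z.
apply: (@le_trans _ _ (`|t p p'| * z p p' * expR (z p p'))).
  apply: ler_pM; rewrite ?expR_ge0 ?E_ge0 ?E_le_cube//.
  by rewrite ler_expR.
rewrite -mulrA ler_wpM2l//.
have -> : 2 * z p p' = z p p' + z p p' by ring.
rewrite (expRD (z p p') (z p p')) ler_wpM2r ?expR_ge0//.
by have := expR_ge1Dx (z p p'); lra.
Qed.

(** The weight is itself at most [|t|], so nothing has to be subtracted from the exponential. *)
Lemma overlap_moment_to0 :
  weighted_second_moment d D (@sprade_vector R rho n) lam del (Num.max 0) <=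
  small_overlap_rest + tail.
Proof.
rewrite -restE -[_^-1 * _]add0r; apply: average_overlap_le => [|p p' pD p'D].
  by rewrite invr_ge0 mulr_ge0// sqrtr_ge0.
have m1 := pos_pow_le pD p'D (ltnW (ltnW d3)); rewrite expr1 in m1.
have m0 : 0 <= Num.max 0 (t p p' ^+ d) by rewrite le_max lexx.
rewrite add0r; case: ifP => _; last first.
  apply: (@le_trans _ _ (1 * expR (E p p'))).
    rewrite ler_wpM2r ?expR_ge0// (le_trans m1)//; exact: t1.
  by rewrite mul1r ler_expR; exact: E_le_rate.
apply: le_trans (norm_expR_le p p'); apply: ler_pM; rewrite ?expR_ge0//.
rewrite ler_expR; apply: le_trans (E_le_rate pD p'D) _.
by apply: le_trans (rate_le_z _ _) _; have := z_ge0 p p'; lra.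
Qed.

End second_moment_bounds.

(** * Impossibility *)

Section dimensions.
Variable R : realType.

Lemma near_sprade_oo (rho : R) (P : nat -> Prop) :
  (\forall n \near \oo, sprade_dim rho n -> P n) ->
  \forall n \near sprade_oo rho, P n.
Proof. by rewrite near_withinE. Qed.

(** Multiples of an admissible dimension are admissible, so one such dimension makes the filter
    proper, and a contradiction at a single large [n] suffices. *)
Lemma sprade_oo_ex (rho : R) (P Q : nat -> Prop) : sprade_dim rho !=set0 ->
  (\forall n \near sprade_oo rho, P n) -> (\forall n \near \oo, Q n) ->
  exists n, [/\ sprade_dim rho n, P n & Q n].
Proof.
move=> [n0 [n00 rn0]]; rewrite near_withinE => hP hQ.
have [N _ hN] : \forall n \near \oo, (sprade_dim rho n -> P n) /\ Q n.
  by apply: filterS2 hP hQ.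
exists (n0 * N.+1)%N.
have dim : sprade_dim rho (n0 * N.+1)%N.
  split; first by rewrite muln_gt0 n00.
  by rewrite natrM mulrA rpredM // natr_nat.
have [|h1 h2] := hN (n0 * N.+1)%N; last by split=> //; exact: h1.
by rewrite /= (leq_trans (leqnSn N))// leq_pmull.
Qed.

Lemma sprade_dim_support (rho : R) n : 0 < rho -> sprade_dim rho n ->
  exists2 k, rho * n%:R = k%:R & (0 < k)%N.
Proof.
move=> r0 [n0 /natrP[k kE]]; exists k => //.
by rewrite -(ltr_nat R) -kE mulr_gt0// ltr0n.
Qed.

Lemma near_expRN_le (c e : R) : 0 < c -> 0 < e ->
  \forall n \near \oo, expR (- (c * n%:R)) <= e.
Proof.
move=> c0 e0; near=> n.
have cn : 0 < c * n%:R.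
  by rewrite mulr_gt0// ltr0n; near: n; exact: nbhs_infty_gt.
rewrite expRN -[e]invrK lef_pV2 ?posrE ?expR_gt0 ?invr_gt0//.
apply: le_trans (expR_ge1Dx _); apply: (@le_trans _ _ (c * n%:R)).
  rewrite mulrC -ler_pdivrMr//; near: n; exact: nbhs_infty_ger.
by rewrite lerDr.
Unshelve. all: by end_near. Qed.

End dimensions.

Section impossibility.
Variables (R : realType) (d : nat) (rho beta lam del : R).
Hypotheses (b0 : 0 < beta) (rho0 : 0 < rho) (r1 : rho <= 1).
Hypothesis rb : rho <= expR (- beta) * (expR (- 3) / 480).
Hypotheses (lam0 : 0 <= lam) (del0 : 0 < del).
Hypothesis lam_lt : lam ^+ 2 + 2 * lam * del <= 4 * rho * beta.
Hypothesis d2 : (2 <= d)%N.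

Let r0 : 0 <= rho := ltW rho0.

Section fixed_dimension.
Variables (n k : nat).
Hypotheses (hk : rho * n%:R = k%:R) (k0 : (0 < k)%N).

Local Notation D := (sparse_signs n rho).
Local Notation X := (sprade rho).

Let XE : X n = uniform_image R D (@sprade_vector R rho n) [tuple 0 | i < n].
Proof. by []. Qed.

Let D0 : D != finset.set0.
Proof. by rewrite -card_gt0 (card_sparse_signs_gt0 hk). Qed.

Let n0 : (0 < n)%N := n_gt0_of_k hk k0 r1.

Let x1 p : p \in D ->
  dotp (sprade_vector rho p) (sprade_vector rho p) = 1.
Proof. by move=> pD; exact: (dotp_sprade_vector_unit hk k0). Qed.

Lemma measurable_test (phi : {mfun tensor R d n >-> bool}) :
  measurable [set t | phi t].
Proof.
have -> : [set t | phi t] = phi @^-1` [set true].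
  by apply/seteqP; split => t /=; [move=> ->|].
by rewrite -[X in measurable X]setTI; exact: measurable_funP.
Qed.

Lemma successE (phi : {mfun tensor R d n >-> bool}) :
  success lam X phi = ((fine (spikedWT d n lam X [set t | phi t]) + 1 -
    fine (WT R d n [set t | phi t])) / 2)%:E.
Proof.
have mA := measurable_test phi.
rewrite /success.
have -> : [set t | ~~ phi t] = ~` [set t | phi t].
  by apply/seteqP; split => t /=; [move/negP|move=> /negP].
rewrite probability_setC//.
rewrite -[spikedWT d n lam X [set t | phi t]]fineK ?fin_num_measure//.
rewrite -[WT R d n [set t | phi t]]fineK ?fin_num_measure//.
by rewrite -EFinB -!EFinM -EFinD /=; congr (_%:E); field.
Qed.

Lemma fine_probability_itv (A : set (tensor R d n))
    (P : probability (tensor R d n) R) : measurable A -> 0 <= fine (P A) <= 1.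
Proof.
move=> mA; rewrite fine_ge0//= -lee_fin fineK ?fin_num_measure//.
exact: probability_le1.
Qed.

Local Notation K := (4 * expR 1 + 2 : R).

(** [K] bounds the second moment: [4 e] plus a tail of at most 2. *)
Lemma strong_success_le (phi : {mfun tensor R d n >-> bool}) :
  score_tail n del <= 1 / 8 ->
  (success lam X phi <= (1 - (4 * (K + 2))^-1)%:E)%E.
Proof.
move=> e8; rewrite successE lee_fin.
have mA := measurable_test phi.
have K2 : 2 < K by have := expR_gt0 (1 : R); lra.
have eta0 : 0 < K^-1 by rewrite invr_gt0; lra.
have := spikedWT_le_strong XE D0 n0 x1 lam0 del0 mA eta0.
have /andP[p00 p01] := fine_probability_itv (WT R d n) mA.
have /andP[p10 p11] := fine_probability_itv (spikedWT d n lam X) mA.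
rewrite -[spikedWT d n lam X [set t | phi t]]fineK ?fin_num_measure//.
rewrite -[WT R d n [set t | phi t]]fineK ?fin_num_measure//.
move: (fine (spikedWT _ _ _ _ _)) (fine (WT _ _ _ _)) p00 p01 p10 p11.
move=> p1 p0 p00 p01 p10 p11; rewrite -EFinM -EFinD lee_fin /=.
have MK := second_moment_bounded hk k0 r1 b0 r0 rb lam_lt d2.
have tl : large_overlap_tail k beta <= 2.
  rewrite /large_overlap_tail ler_piMr// -[leRHS]expR0 ler_expR oppr_le0.
  by rewrite divr_ge0// mulr_ge0// ltW.
have {}MK := le_trans MK (lerD (lexx (4 * expR 1)) tl).
have h1 : K^-1 / 2 * weighted_second_moment d D (@sprade_vector R rho n) lam del
    (cst 1) <= 1 / 2.
  apply: le_trans (ler_wpM2l _ MK) _; first by rewrite divr_ge0// ltW.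
  by rewrite le_eqVlt; apply/orP; left; apply/eqP; field; rewrite gt_eqF//; lra.
move=> h.
have h2 : p1 <= 5 / 8 + K / 2 * p0.
  have hK : (2 * K^-1)^-1 = K / 2 by rewrite invfM invrK mulrC.
  by move: h; rewrite hK => /le_trans; apply; rewrite lerD2r; lra.
set c := (4 * (K + 2))^-1.
have cE : c * (4 * (K + 2)) = 1 by rewrite mulVf// gt_eqF//; lra.
have c0 : 0 < c by rewrite invr_gt0; lra.
clearbody c; move: K2 h2 cE; move: (K) => L L2 h2 cE.
(* If [2 c <= p0], the null error alone costs [c]; otherwise [p1 <= 5 / 8 + K c], with
   [(K + 2) c = 1 / 4]. *)
have [pc|pc] := leP (2 * c) p0; first by lra.
have : L * p0 <= L * (2 * c) by rewrite ler_pM2l; lra.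
nra.
Qed.

Hypothesis d3 : (3 <= d)%N.

(** With [eta = eps] the advantage [p1 - p0] is at most [3 / 2 * eps], and the success probability
    gains half of it. *)
Lemma weak_success_lt (phi : {mfun tensor R d n >-> bool}) (eps : R) :
  0 < eps -> score_tail n del <= eps ^+ 2 / 4 -> score_tail n del <= eps / 2 ->
  large_overlap_tail k beta <= eps ^+ 2 / 4 ->
  small_overlap_rest k beta <= eps ^+ 2 / 4 ->
  (success lam X phi < (2^-1 + eps)%:E)%E.
Proof.
move=> eps0 e1 e2 tl rs; rewrite successE lte_fin.
have mA := measurable_test phi.
have := spikedWT_le_weak XE D0 n0 x1 lam0 del0 mA eps0.
rewrite -[spikedWT d n lam X [set t | phi t]]fineK ?fin_num_measure//.
rewrite -[WT R d n [set t | phi t]]fineK ?fin_num_measure//.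
move: (fine (spikedWT _ _ _ _ _)) (fine (WT _ _ _ _)) => p1 p0.
rewrite -EFinD lee_fin /=.
have M1 := second_moment_to1 hk k0 r1 b0 r0 rb lam0 del0 lam_lt d2 d3.
have : (weighted_second_moment d D (@sprade_vector R rho n) lam del (cst 1) - 1 +
    2 * score_tail n del) / (2 * eps) <= eps / 2.
  rewrite ler_pdivrMr ?mulr_gt0//.
  rewrite (_ : eps / 2 * (2 * eps) = eps ^+ 2); last by field.
  lra.
lra.
Qed.

Lemma recovery_lt (xhat : {mfun tensor R d n >-> n.-tuple R}) (eps : R) :
  (forall t, Num.sqrt (dotp (xhat t) (xhat t)) = 1) ->
  0 < eps -> score_tail n del <= eps / 8 ->
  large_overlap_tail k beta <= eps ^+ 2 / 8 ->
  small_overlap_rest k beta <= eps ^+ 2 / 8 ->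
  ('E_(spike_noise d n X)[fun p => (dotp p.1 (xhat (spike lam p)) ^+ d)%R] <
   eps%:E)%E.
Proof.
move=> xh1 eps0 e1 tl rs.
have {}xh1 t : dotp (xhat t) (xhat t) = 1.
  (* [Num.sqrt] is 0 on negative reals, so the value 1 excludes them. *)
  have := xh1 t; have [x0|x0] := leP 0 (dotp (xhat t) (xhat t)).
    by move=> h; rewrite -[LHS]sqr_sqrtr// h expr1n.
  by rewrite ltr0_sqrtr// => /esym/eqP; rewrite oner_eq0.
apply: le_lt_trans (recovery_le XE D0 n0 x1 lam0 del0 xh1 eps0) _.
rewrite lte_fin.
have M1 := overlap_moment_to0 hk k0 r1 b0 r0 rb lam_lt d2 d3.
have : weighted_second_moment d D (@sprade_vector R rho n) lam del (Num.max 0) /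
    (2 * eps) <= eps / 8.
  rewrite ler_pdivrMr ?mulr_gt0//.
  rewrite (_ : eps / 8 * (2 * eps) = eps ^+ 2 / 4); last by field.
  lra.
lra.
Qed.

End fixed_dimension.

Let near_score_tail e : 0 < e -> \forall n \near \oo, score_tail n del <= e :> R.
Proof.
move=> e0; have c0 : 0 < del ^+ 2 / 4 by rewrite divr_gt0// exprn_gt0.
apply: filterS (near_expRN_le c0 e0) => n.
rewrite /score_tail; have -> : n%:R * del ^+ 2 / 4 = del ^+ 2 / 4 * n%:R by field.
by [].
Qed.

Let near_large_overlap_tail e : 0 < e ->
  \forall n \near \oo, forall k, rho * n%:R = k%:R ->
    large_overlap_tail k beta <= e :> R.
Proof.
move=> e0; have c0 : 0 < rho / (96 * beta) by rewrite divr_gt0// mulr_gt0.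
have e2 : 0 < e / 2 by rewrite divr_gt0.
apply: filterS (near_expRN_le c0 e2) => n h k hk.
rewrite /large_overlap_tail -hk.
rewrite (_ : _ / _ = rho / (96 * beta) * n%:R); last by rewrite mulrAC.
by move: h; set y := expR _; lra.
Qed.

Let near_small_overlap_rest e : 0 < e ->
  \forall n \near \oo, forall k, rho * n%:R = k%:R ->
    small_overlap_rest k beta <= e :> R.
Proof.
move=> e0; near=> n => k hk.
have n0 : 0 < n%:R :> R by rewrite ltr0n; near: n; exact: nbhs_infty_gt.
have s0 : 0 < Num.sqrt (k%:R * beta) by rewrite sqrtr_gt0 -hk !mulr_gt0.
rewrite /small_overlap_rest ler_pdivrMr// mulrC -ler_pdivrMr//.
rewrite -[leLHS]ger0_norm ?divr_ge0 ?expR_ge0 ?(ltW e0)//.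
rewrite -sqrtr_sqr ler_wsqrtr// -hk -mulrA mulrCA -ler_pdivrMr ?mulr_gt0//.
near: n; exact: nbhs_infty_ger.
Unshelve. all: by end_near. Qed.

Hypothesis dim0 : sprade_dim rho !=set0.

Lemma strong_detection_impossible :
  ~ strong_detection (sprade_oo rho) d lam (sprade rho).
Proof.
move=> [phi phi1].
set K := 4 * expR 1 + 2 : R.
pose c : R := (4 * (K + 2))^-1.
have c0 : 0 < c by rewrite invr_gt0 /K; have := expR_gt0 (1 : R); lra.
have near1 : \forall n \near sprade_oo rho,
    ((1 - c)%:E < success lam (sprade rho) (phi n))%E.
  have nb : nbhs (1%E : \bar R) [set x | ((1 - c)%:E < x)%E].
    apply: open_nbhs_nbhs; split; first exact: open_ereal_gt_ereal.
    by rewrite /= lte_fin; lra.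
  exact: (phi1 _ nb).
have e8 : 0 < 1 / 8 :> R by lra.
have [n [dimn h1 h2]] := sprade_oo_ex dim0 near1 (near_score_tail e8).
have [k hk k0] := sprade_dim_support rho0 dimn.
by have := strong_success_le hk k0 (phi n) h2; rewrite leNgt h1.
Qed.

Hypothesis d3 : (3 <= d)%N.

Lemma weak_detection_impossible :
  ~ weak_detection (sprade_oo rho) d lam (sprade rho).
Proof.
move=> [phi [eps [eps0 near1]]].
have e1 : 0 < eps ^+ 2 / 4 by rewrite divr_gt0// exprn_gt0.
have e2 : 0 < eps / 2 by rewrite divr_gt0.
have [n [dimn h1 [[h2 h3] [h4 h5]]]] := sprade_oo_ex dim0 near1
  (filterI (filterI (near_score_tail e1) (near_score_tail e2))
   (filterI (near_large_overlap_tail e1) (near_small_overlap_rest e1))).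
have [k hk k0] := sprade_dim_support rho0 dimn.
have := weak_success_lt hk k0 d3 (phi n) eps0 h2 h3 (h4 _ hk) (h5 _ hk).
by rewrite ltNge h1.
Qed.

Lemma weak_recovery_impossible :
  ~ weak_recovery (sprade_oo rho) d lam (sprade rho).
Proof.
move=> [xhat [eps [xh1 eps0 near1]]].
have e1 : 0 < eps ^+ 2 / 8 by rewrite divr_gt0// exprn_gt0.
have e2 : 0 < eps / 8 by rewrite divr_gt0.
have [n [dimn h1 [h2 [h4 h5]]]] := sprade_oo_ex dim0 near1
  (filterI (near_score_tail e2)
   (filterI (near_large_overlap_tail e1) (near_small_overlap_rest e1))).
have [k hk k0] := sprade_dim_support rho0 dimn.
have n0 : (0 < n)%N by case: dimn.
have := recovery_lt hk k0 d3 (fun t => xh1 n t n0) eps0 h2 (h4 _ hk) (h5 _ hk).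
by rewrite ltNge h1.
Qed.

End impossibility.

(** * Possibility *)

Section candidates.
Variables (R : realType) (rho : R) (n : nat).

(* A sparse vector is given without redundancy by its support and the set of its
   negative entries, so that there are [C(n, k) 2^k] candidates. *)
Definition candidate_index : {set {set 'I_n} * {set 'I_n}} :=
  [set q : {set 'I_n} * {set 'I_n} |
    (#|q.1|%:R == rho * n%:R) && (q.2 \subset q.1)]%SET.

Definition candidates : seq (n.-tuple R) :=
  [seq sprade_vector rho (q.1, [ffun i => i \in q.2])
    | q : {set 'I_n} * {set 'I_n} <- enum candidate_index].

Lemma mem_candidates p : p \in sparse_signs n rho ->
  sprade_vector rho p \in candidates.
Proof.
case: p => S e; rewrite inE/= => Sk.
apply/mapP; exists (S, [set i in S | e i]%SET).
  rewrite mem_enum inE/= Sk/=; apply/fintype.subsetP => i.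
  by rewrite inE => /andP[].
apply: eq_from_tnth => i; rewrite !tnth_mktuple/= ffunE inE.
by case: (i \in S).
Qed.

Lemma candidates_unit v : 0 < rho -> (0 < n)%N -> v \in candidates ->
  dotp v v = 1.
Proof.
move=> rho0 n0 /mapP[q]; rewrite mem_enum inE => /andP[/eqP qk _] ->.
have q0 : (0 < #|q.1|)%N.
  by rewrite -(ltr_nat R) qk mulr_gt0// ltr0n.
by apply: (dotp_sprade_vector_unit (esym qk) q0); rewrite inE qk.
Qed.

Lemma size_candidates k : rho * n%:R = k%:R ->
  size candidates = ('C(n, k) * 2 ^ k)%N.
Proof.
move=> hk; rewrite size_map -cardE -sum1_card.
rewrite (eq_bigl (fun q : {set 'I_n} * {set 'I_n} =>
    (#|q.1| == k) && (q.2 \subset q.1))); last first.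
  by move=> q; rewrite inE hk eqr_nat.
rewrite -(pair_big_dep (fun S : {set 'I_n} => #|S| == k)
  (fun S T : {set 'I_n} => T \subset S) (fun _ _ => 1%N))/=.
rewrite (eq_bigr (fun=> 2 ^ k)%N).
  by rewrite sum_nat_cond_const card_draws card_ord.
move=> S /eqP <-; rewrite -card_powerset -sum1_card.
by apply: eq_bigl => T; rewrite inE.
Qed.

(** A single term of the expansion of [(1 - rho + rho) ^+ n = 1] is at most 1. *)
Lemma binomial_entropy_le k : 0 < rho <= 1 -> rho * n%:R = k%:R ->
  'C(n, k)%:R <= expR (n%:R * entropy rho).
Proof.
move=> /andP[rho0 r1] hk.
have kn : (k <= n)%N by rewrite -(ler_nat R) -hk ler_piMl.
(* Treated apart because [1 - rho] is recovered from its logarithm below, which needs it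
   positive. *)
have [rE|rho1] := eqVneq rho 1.
  have -> : k = n by apply/eqP; rewrite -(eqr_nat R) -hk rE mul1r.
  by rewrite binn rE /entropy ln1 subrr mulr0 mul0r subrr mulr0 expR0.
have b0 : 0 < 1 - rho by rewrite subr_gt0 lt_neqAle rho1.
have -> : n%:R * entropy rho =
    - (k%:R * ln rho + (n - k)%N%:R * ln (1 - rho)).
  by rewrite natrB// -hk /entropy; ring.
rewrite expRN -[leRHS]mul1r ler_pdivlMr ?expR_gt0// expRD !expRM_natl.
rewrite !lnK ?posrE//.
have e1 : (1 - rho + rho) ^+ n = 1 by rewrite subrK expr1n.
rewrite -[leRHS]e1 [leRHS]exprDn (bigD1 (inord k : 'I_n.+1))//= inordK// -[leLHS]addr0 lerD//.
  by rewrite mulr_natl [rho ^+ k * _]mulrC.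
by apply: sumr_ge0 => i _; rewrite mulrn_wge0// mulr_ge0// exprn_ge0// ltW.
Qed.
End candidates.

Section score_test.
Variables (R : realType) (d n : nat).
Hypothesis n0 : (0 < n)%N.
Local Notation N := (n%:R : R).
Local Notation sigma := (Num.sqrt (2 / N)).
Local Notation G := (iid (gaussian sigma) #|{: d.-tuple 'I_n}|).
Local Opaque iid.

Definition score_test (a : R) (s : seq (n.-tuple R)) (t : tensor R d n) : bool :=
  has (fun v => a <= dotp (rank1 d v) t) s.

Lemma measurable_score_test a s :
  measurable_fun [set: tensor R d n] (score_test a s).
Proof.
elim: s => [|v s IH]; first exact: measurable_cst.
apply: measurable_or => //; apply: measurable_fun_ler => //.
exact: measurable_dotp.
Qed.

Lemma score_test_symmetrize a s (w : tensor R d n) :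
  score_test a s (symmetrize w) = score_test a s w.
Proof. by apply: eq_has => v; rewrite dotp_rank1_symmetrize. Qed.

Lemma measurable_score_test_set a s :
  measurable [set t : tensor R d n | score_test a s t].
Proof.
have -> : [set t | score_test a s t] = score_test a s @^-1` [set true].
  by apply/seteqP; split => t /=; [move=> ->|].
by rewrite -[X in measurable X]setTI; exact: measurable_score_test.
Qed.

Lemma score_tail_le a (v : n.-tuple R) : 0 <= a -> dotp v v = 1 ->
  (G [set w | (a <= dotp (rank1 d v) w)%R] <= (score_tail n a)%:E)%E.
Proof.
move=> a0 v1; apply: le_trans (iid_dotp_tail (sigma_neq0 R n0) a0 _) _.
  by rewrite dotp_rank1 v1 expr1n.
rewrite lee_fin /score_tail sigma_sqr ler_expR le_eqVlt; apply/orP; left.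
by apply/eqP; field; rewrite gt_eqF// ltr0n.
Qed.

Lemma score_test_null a s : 0 <= a -> (forall v, v \in s -> dotp v v = 1) ->
  (G [set w | score_test a s w] <= ((size s)%:R * score_tail n a)%:E)%E.
Proof.
move=> a0; elim: s => [|v s IH] s1.
  by rewrite mul0r (_ : [set w | _] = set0) ?measure0//; apply/seteqP; split.
rewrite (_ : [set w | score_test a (v :: s) w] =
    [set w | a <= dotp (rank1 d v) w] `|` [set w | score_test a s w]); last first.
  by apply/seteqP; split => w /=; [move/orP|move=> H; apply/orP].
have m1 : measurable [set w : tensor R d n | a <= dotp (rank1 d v) w].
  rewrite -[X in measurable X]setTI.
  by apply: measurable_fun_le => //; exact: measurable_dotp.
apply: le_trans (measureU2 _ m1 (measurable_score_test_set a s)) _.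
have -> : ((size (v :: s))%:R * score_tail n a)%:E =
    ((score_tail n a)%:E + ((size s)%:R * score_tail n a)%:E)%E.
  by rewrite -EFinD /= -[(size s).+1%:R]natr1 mulrDl mul1r addrC.
apply: leeD.
  by apply: score_tail_le => //; apply: s1; rewrite mem_head.
by apply: IH => u us; apply: s1; rewrite in_cons us orbT.
Qed.

(* A candidate above the threshold recovers the spike as well as the one with the
   largest score, and selecting it is visibly measurable. *)
Fixpoint first_candidate (a : R) (v0 : n.-tuple R) (s : seq (n.-tuple R))
    (t : tensor R d n) : n.-tuple R :=
  if s is v :: s' then
    if a <= dotp (rank1 d v) t then v else first_candidate a v0 s' t
  else v0.

Lemma measurable_first_candidate a v0 s :
  measurable_fun [set: tensor R d n] (first_candidate a v0 s).
Proof.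
elim: s => [|v s IH]; first exact: measurable_cst.
apply: measurable_fun_ifT => //; apply: measurable_fun_ler => //.
exact: measurable_dotp.
Qed.

Lemma first_candidateP a v0 s t : let v := first_candidate a v0 s t in
  if score_test a s t then v \in s /\ a <= dotp (rank1 d v) t else v = v0.
Proof.
elim: s => [|u s IH]//=; rewrite /score_test/=.
have [au|_] := boolP (a <= dotp (rank1 d u) t); first by rewrite mem_head.
rewrite /=.
move: IH; rewrite -/(score_test a s t); case: ifP => // _ [h1 h2].
by split=> //; rewrite in_cons h1 orbT.
Qed.

End score_test.

HB.instance Definition _ (R : realType) d n a (s : seq (n.-tuple R)) :=
  @isMeasurableFun.Build _ _ _ _ (@score_test R d n a s)
    (@measurable_score_test R d n a s).
HB.instance Definition _ (R : realType) d n a v0 (s : seq (n.-tuple R)) :=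
  @isMeasurableFun.Build _ _ _ _ (@first_candidate R d n a v0 s)
    (@measurable_first_candidate R d n a v0 s).

Section possibility.
Variables (R : realType) (d : nat) (rho lam thr noise : R).
Hypotheses (rho0 : 0 < rho) (r1 : rho <= 1).
Local Notation H := (entropy rho + rho * ln 2).
Hypotheses (noise0 : 0 <= noise) (H_lt : H < noise ^+ 2 / 4).
Hypotheses (noise_thr : noise < thr) (thr_lam : thr < lam).

Let lam0 : 0 < lam.
Proof. by apply: lt_trans thr_lam; exact: le_lt_trans noise_thr. Qed.

(** Union bound: [expR (n H)] candidates times the tail [expR (- n a^2 / 4)]. Detection uses it at
    [thr], recovery at [noise]. *)
Definition null_error (a : R) n : R := expR (- ((a ^+ 2 / 4 - H) * n%:R)).

Section fixed_dimension.
Variables (n k : nat).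
Hypotheses (hk : rho * n%:R = k%:R) (k0 : (0 < k)%N).

Local Notation D := (sparse_signs n rho).
Local Notation X := (sprade rho).
Local Notation s := (candidates rho n).
Local Notation G :=
  (iid (gaussian (Num.sqrt (2 / n%:R))) #|{: d.-tuple 'I_n}|).
Local Notation miss := (score_tail n (lam - thr)).
Local Opaque iid.

Let XE : X n = uniform_image R D (@sprade_vector R rho n) [tuple 0 | i < n].
Proof. by []. Qed.

Let D0 : D != finset.set0.
Proof. by rewrite -card_gt0 (card_sparse_signs_gt0 hk). Qed.

Let n0 : (0 < n)%N := n_gt0_of_k hk k0 r1.

Let x1 p : p \in D ->
  dotp (sprade_vector rho p) (sprade_vector rho p) = 1.
Proof. by move=> pD; exact: (dotp_sprade_vector_unit hk k0). Qed.

Let s1 v : v \in s -> dotp v v = 1.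
Proof. exact: candidates_unit. Qed.

Lemma size_candidates_le : (size s)%:R <= expR (n%:R * H) :> R.
Proof.
rewrite (size_candidates hk) natrM mulrDr expRD.
rewrite ler_pM// ?binomial_entropy_le ?rho0//.
by rewrite mulrCA mulrA hk expRM_natl lnK ?posrE// natrX.
Qed.

Lemma candidates_null a : 0 <= a ->
  (G [set w | score_test a s w] <= (null_error a n)%:E)%E.
Proof.
move=> a0; apply: le_trans (score_test_null d n0 a0 s1) _.
rewrite lee_fin; apply: le_trans (ler_wpM2r _ size_candidates_le) _.
  exact: expR_ge0.
rewrite /score_tail -expRD ler_expR /null_error le_eqVlt; apply/orP; left.
by apply/eqP; field.
Qed.

(** The noise that brings the score of the true spike, [lam] plus noise, down to [thr] or below. *)
Definition low_score p : set (tensor R d n) :=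
  [set w | dotp (rank1 d (sprade_vector rho p)) w <= - (lam - thr)].

Lemma measurable_low_score p : measurable (low_score p).
Proof.
rewrite -[X in measurable X]setTI.
by apply: measurable_fun_le => //; exact: measurable_dotp.
Qed.

Lemma low_score_le p : p \in D -> (G (low_score p) <= miss%:E)%E.
Proof.
move=> pD; have lt0 : 0 <= lam - thr by rewrite subr_ge0 ltW.
rewrite (_ : low_score p = [set w | lam - thr <=
    dotp (scalet (-1) (rank1 d (sprade_vector rho p))) w]); last first.
  by apply/seteqP; split=> w; rewrite /low_score/= dotpZl mulN1r lerNr.
apply: le_trans (iid_dotp_tail (sigma_neq0 R n0) lt0 _) _.
  by rewrite dotpZl dotpZr dotp_rank1 x1// expr1n mulr1 mulN1r opprK.
rewrite lee_fin /score_tail sigma_sqr ler_expR le_eqVlt; apply/orP; left.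
by apply/eqP; field; rewrite gt_eqF// ltr0n.
Qed.

Lemma signal_detected p w : p \in D -> ~ low_score p w ->
  score_test thr s (spike lam (sprade_vector rho p, symmetrize w)).
Proof.
move=> pD /negP; rewrite -ltNge => lw; apply/hasP.
exists (sprade_vector rho p); first exact: mem_candidates.
rewrite dotp_rank1_spike x1// expr1n mulr1 dotp_rank1_symmetrize.
by move: lw; lra.
Qed.

Let WT_A : (WT R d n [set t | score_test thr s t] <= (null_error thr n)%:E)%E.
Proof.
have mA := measurable_score_test_set (d := d) thr s.
rewrite WT_indic//; apply: le_trans (candidates_null _); last first.
  by apply: le_trans noise0 _; exact: ltW.
rewrite -[X in (_ <= G X)%E]setIT -integral_indic// le_eqVlt; apply/orP; left.
apply/eqP; apply: eq_integral => w _; rewrite !indicE; congr ((nat_of_bool _)%:R%:E).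
by apply/idP/idP; rewrite !inE/= score_test_symmetrize.
Qed.

Let spiked_A :
  (spikedWT d n lam X (~` [set t | score_test thr s t]) <= miss%:E)%E.
Proof.
have mA := measurableC (measurable_score_test_set (d := d) thr s).
have mI : measurable_fun [set: tensor R d n]
  (\1_(~` [set t | score_test thr s t]) : tensor R d n -> R).
  exact: measurable_indic.
rewrite spikedWT_indic// (ge0_integral_spike_noise XE D0
  (g := fun p => \1_(~` [set t | score_test thr s t]) (spike lam p)))//; last first.
  by apply: measurableT_comp => //; exact: measurable_spike.
rewrite -(esum_card_inv D0 miss) lee_wpmul2l ?lee_fin ?card_inv_ge0//.
apply: lee_sum => p pD; apply: le_trans (low_score_le pD).
rewrite -[X in (_ <= G X)%E]setIT -integral_indic//; last first.
  exact: measurable_low_score.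
have mL := measurable_low_score p.
apply: le_integral_EFin => //.
- apply: (measurableT_comp mI).
  apply: (measurableT_comp (f := fun t => spike lam (sprade_vector rho p, t))).
    exact: measurableT_comp (measurable_spike _) (pair1_measurable _).
  exact: measurable_symmetrize.
- move=> w; rewrite !indicE ler_nat.
  have [|//] := boolP (spike _ _ \in _); rewrite inE/= => nA.
  rewrite (_ : w \in low_score p)// inE; apply: contrapT => /(signal_detected pD).
  exact: nA.
Qed.

Lemma detection_success_ge :
  ((1 - null_error thr n - miss)%:E <= success lam X (score_test (d := d) thr s))%E.
Proof.
rewrite successE lee_fin.
have mA := measurable_score_test_set (d := d) thr s.
have := spiked_A; have := WT_A.
rewrite probability_setC//.
have /andP[p00 p01] := fine_probability_itv (WT R d n) mA.
have /andP[p10 p11] := fine_probability_itv (spikedWT d n lam X) mA.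
rewrite -[spikedWT d n lam X _]fineK ?fin_num_measure//.
rewrite -[WT R d n _]fineK ?fin_num_measure//.
move: (fine (spikedWT _ _ _ _ _)) (fine (WT _ _ _ _)) p00 p01 p10 p11.
move=> p1 p0 p00 p01 p10 p11; rewrite -EFinB !lee_fin /=.
have := expR_ge0 (- ((thr ^+ 2 / 4 - H) * n%:R)).
have := expR_ge0 (- (n%:R * (lam - thr) ^+ 2 / 4)).
by rewrite /null_error /score_tail; lra.
Qed.

Local Notation c := ((thr - noise) / lam).

(** The selected [v] depends on the noise, so its noise score is controlled by a bound over all
    candidates. When that bound holds and the true spike passes, [lam * overlap + noise > thr]
    forces an overlap of at least [c]; each of the two failures costs at most 2, as [c + 1 <= 2]. *)
Lemma recovery_ge (v0 : n.-tuple R) : dotp v0 v0 = 1 ->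
  ((c - 2 * (null_error noise n + miss))%:E <=
   'E_(spike_noise d n X)[fun p =>
     (dotp p.1 (first_candidate (d := d) thr v0 s (spike lam p)) ^+ d)%R])%E.
Proof.
move=> v01; pose xh := first_candidate (d := d) thr v0 s.
have xh1 t : dotp (xh t) (xh t) = 1.
  have := first_candidateP thr v0 s t; rewrite -/xh/=.
  by case: ifP => [_ [/s1]|_ ->].
pose f (p : n.-tuple R * tensor R d n) := dotp p.1 (xh (spike lam p)) ^+ d.
have mxh : measurable_fun [set: tensor R d n] xh.
  exact: measurable_first_candidate.
have mf : measurable_fun [set: n.-tuple R * tensor R d n] f.
  apply: measurable_funX; apply: measurable_sum => j; apply: measurable_funM.
    exact: measurableT_comp (measurable_tnth _) measurable_fst.
  apply: measurableT_comp (measurable_tnth _) _.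
  by apply: measurableT_comp => //; exact: measurable_spike.
have f1 p t : p \in D -> `|f (sprade_vector rho p, t)| <= 1.
  move=> pD; rewrite /f normrX exprn_ile1//.
  by apply: dotp_unit_le1 => //; exact: x1.
rewrite (expectation_bounded XE D0 mf f1).
have mc : measurable_fun [set: n.-tuple R * tensor R d n]
    (fun p => 1 + clamp (f p)).
  by apply: measurable_funD => //; exact: measurable_clamp.
rewrite (ge0_integral_spike_noise XE D0 mc (fun p => clamp_ge (f p))).
rewrite leeBrDr// -EFinD -(esum_card_inv D0).
rewrite lee_wpmul2l ?lee_fin ?card_inv_ge0//; apply: lee_sum => p pD.
pose A : set (tensor R d n) := [set w | score_test noise s w].
have mA : measurable A by exact: measurable_score_test_set.
have mL := measurable_low_score p.
have mg : measurable_fun [set: tensor R d n]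
    (fun w => 1 + clamp (f (sprade_vector rho p, symmetrize w))).
  apply: (measurableT_comp (f := fun t => 1 + clamp (f (sprade_vector rho p, t)))).
    exact: (measurableT_comp mc (pair1_measurable _)).
  exact: measurable_symmetrize.
have c0 : 0 < c by rewrite divr_gt0// subr_gt0.
have c1 : c <= 1.
  by rewrite ler_pdivrMr// mul1r; move: noise0 thr_lam; lra.
have key : ((c + 1)%:E <= \int[G]_w
   (1 + clamp (f (sprade_vector rho p, symmetrize w)))%:E +
   (2%:E * G A + 2%:E * G (low_score p)))%E.
  have -> : ((c + 1)%:E = \int[G]_w (c + 1)%:E)%E.
    by rewrite integral_cst//= probability_setT mule1.
  have GE (B : set (tensor R d n)) : measurable B -> (G B = \int[G]_w (\1_B w : R)%:E)%E.
    by move=> mB; rewrite integral_indic// setIT.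
  rewrite (GE A mA) (GE _ mL) -!integral_EFinZl//.
  have mI (B : set (tensor R d n)) : measurable B ->
      measurable_fun [set: tensor R d n] (fun w => 2 * \1_B w : R).
    by move=> mB; apply: measurable_funM.
  have I0 (B : set (tensor R d n)) w : 0 <= 2 * (\1_B w : R) by rewrite mulr_ge0.
  rewrite -(integral_EFinD G (mI _ mA) (mI _ mL) (I0 A) (I0 (low_score p))).
  have mII := measurable_funD (mI _ mA) (mI _ mL).
  rewrite -(integral_EFinD G mg mII (fun w => clamp_ge _)
    (fun w => addr_ge0 (I0 A w) (I0 (low_score p) w))).
  apply: le_integral_EFin.
  - exact: measurable_cst.
  - exact: measurable_funD.
  - by move=> w; rewrite addr_ge0// ltW.
  move=> w; have cg := clamp_ge (f (sprade_vector rho p, symmetrize w)).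
  rewrite /= !indicE.
  have [wA|wA] := boolP (w \in A); first by case: (_ \in _) => /=; lra.
  have [wL|wL] := boolP (w \in low_score p); first by rewrite /=; lra.
  rewrite /= !mulr0 !addr0 addrC lerD2l clampE ?f1//.
  have tst : score_test thr s (spike lam (sprade_vector rho p, symmetrize w)).
    by apply: signal_detected => //; move/mem_set; exact/negP.
  have := first_candidateP thr v0 s (spike lam (sprade_vector rho p, symmetrize w)).
  rewrite tst -/xh /= => -[vs]; rewrite dotp_rank1_spike dotp_rank1_symmetrize.
  rewrite /f/= dotpC; set v := xh _ in vs *.
  have vw : dotp (rank1 d v) w < noise.
    rewrite ltNge; apply/negP => nv; move/negP: wA; apply; apply/mem_set.
    by apply/hasP; exists v.
  by move=> tv; rewrite ler_pdivrMr// mulrC; lra.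
have h1 := candidates_null noise0; have h2 := low_score_le pD.
rewrite -/A in h1.
have := key; rewrite -[G A]fineK ?fin_num_measure//.
rewrite -[G (low_score p)]fineK ?fin_num_measure//.
move: h1 h2; rewrite -[G A]fineK ?fin_num_measure//.
rewrite -[G (low_score p)]fineK ?fin_num_measure// !lee_fin => h1 h2.
rewrite -!EFinM -EFinD -leeBlDr// -EFinB; apply: le_trans.
by rewrite lee_fin; lra.
Qed.

End fixed_dimension.

Let near_null_error a e : noise <= a -> 0 < e ->
  \forall n \near \oo, null_error a n <= e.
Proof.
move=> na e0; apply: near_expRN_le => //.
rewrite subr_gt0 (lt_le_trans H_lt)// ler_pM2r ?invr_gt0//.
by rewrite ler_sqr ?nnegrE// (le_trans noise0).
Qed.

Let near_miss e : 0 < e ->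
  \forall n \near \oo, score_tail n (lam - thr) <= e :> R.
Proof.
move=> e0; have c0 : 0 < (lam - thr) ^+ 2 / 4.
  by rewrite divr_gt0// exprn_gt0// subr_gt0.
apply: filterS (near_expRN_le c0 e0) => n.
rewrite /score_tail.
by have -> : n%:R * (lam - thr) ^+ 2 / 4 = (lam - thr) ^+ 2 / 4 * n%:R by field.
Qed.

Lemma strong_detection_possible :
  strong_detection (sprade_oo rho) d lam (sprade rho).
Proof.
exists (fun n => score_test (d := d) thr (candidates rho n)
  : {mfun tensor R d n >-> bool}).
under eq_fun do rewrite successE.
apply: cvg_EFin; first by apply: nearW.
rewrite /sprade_oo; apply/cvgrPdist_le => e e0 /=.
have e2 : 0 < e / 2 by rewrite divr_gt0.
rewrite -/(sprade_oo rho); apply: near_sprade_oo.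
apply: filterS2 (near_null_error (ltW noise_thr) e2) (near_miss e2) => n h1 h2 dn.
have [k hk k0] := sprade_dim_support rho0 dn.
have := detection_success_ge hk k0; rewrite successE lee_fin.
have mA := measurable_score_test_set (d := d) thr (candidates rho n).
have /andP[p00 p01] := fine_probability_itv (WT R d n) mA.
have /andP[p10 p11] := fine_probability_itv (spikedWT d n lam (sprade rho)) mA.
by move=> h; rewrite ler_norml; apply/andP; split; lra.
Qed.

Lemma weak_recovery_possible :
  weak_recovery (sprade_oo rho) d lam (sprade rho).
Proof.
(* The first basis vector, a unit default when no candidate reaches the threshold. *)
pose v0 n : n.-tuple R := [tuple (val i == 0)%N%:R | i < n].
have v01 n : (0 < n)%N -> dotp (v0 n) (v0 n) = 1.
  case: n => // n _; rewrite /dotp (bigD1 ord0)//= !tnth_mktuple mulr1 big1.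
    by rewrite addr0.
  by move=> i; rewrite -val_eqE /= => /negbTE i0; rewrite tnth_mktuple i0 mul0r.
set c := (thr - noise) / lam.
have c0 : 0 < c by rewrite divr_gt0// subr_gt0.
exists (fun n => first_candidate (d := d) thr (v0 n) (candidates rho n)
  : {mfun tensor R d n >-> n.-tuple R}), (c / 2).
split; last 2 first.
- by rewrite divr_gt0.
- have e0 : 0 < c / 8 by rewrite divr_gt0.
  apply: near_sprade_oo.
  apply: filterS2 (near_null_error (lexx _) e0) (near_miss e0) => n h1 h2 dn.
  have [k hk k0] := sprade_dim_support rho0 dn.
  have n0 : (0 < n)%N by case: dn.
  apply: le_trans (recovery_ge hk k0 (v01 n n0)).
  by rewrite lee_fin -/c; lra.
- move=> n t n0.
  have := first_candidateP thr (v0 n) (candidates rho n) t => /=.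
  case: ifP => [_ [/(candidates_unit rho0 n0) -> _]|_ ->]; first by rewrite sqrtr1.
  by rewrite v01// sqrtr1.
Qed.

End possibility.


(** * Asymptotics of the two thresholds *)

Section asymptotics.
Variable R : realType.

Lemma sqrt_rho_log_rho_asymp_bounded (f r : R -> R) (K : R) : 0 < K ->
  (\forall rho \near 0^'+, f rho = 2 * Num.sqrt (- rho * ln rho + r rho)) ->
  (forall rho, 0 < rho < 1 -> `|r rho| <= K * rho) ->
  sqrt_rho_log_rho_asymp f.
Proof.
move=> K0 fE rK; exists r => //; apply/eqO_exP; exists K => //.
near=> rho.
have rho0 : 0 < rho by near: rho; exact: nbhs_right_gt.
rewrite [`|rho|]gtr0_norm// rK// rho0 /=.
by near: rho; exact: nbhs_right_lt.
Unshelve. all: by end_near. Qed.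

(** The upper bound is [ln y <= y - 1] at [y = (1 - rho)^-1], multiplied by [1 - rho]; it puts this
    half of the entropy into the [O(rho)] term. *)
Lemma complement_entropy_itv (rho : R) : 0 < rho < 1 ->
  0 <= - ((1 - rho) * ln (1 - rho)) <= rho.
Proof.
move=> /andP[rho0 rho1]; have b0 : 0 < 1 - rho by rewrite subr_gt0.
apply/andP; split.
  by rewrite oppr_ge0 pmulr_rle0// ln_le0//; lra.
have ib : 0 < (1 - rho)^-1 by rewrite invr_gt0.
have : ln (1 + ((1 - rho)^-1 - 1)) <= (1 - rho)^-1 - 1.
  by apply: le_ln1Dx; lra.
have -> : 1 + ((1 - rho)^-1 - 1) = (1 - rho)^-1 by ring.
rewrite lnV ?posrE// -(ler_pM2l b0) mulrBr mulfV ?gt_eqF//; lra.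
Qed.

Lemma upper_threshold_asymp : sqrt_rho_log_rho_asymp
  (fun rho : R => 2 * Num.sqrt (entropy rho + rho * ln 2)).
Proof.
have l2 : 0 <= ln 2 :> R by rewrite ln_ge0// ler1n.
apply: (sqrt_rho_log_rho_asymp_bounded (K := 1 + ln 2)
  (r := fun rho => - ((1 - rho) * ln (1 - rho)) + rho * ln 2)).
- by rewrite ltr_pwDl.
- by near=> rho; rewrite /entropy addrA.
- move=> rho rho01; have /andP[e0 e1] := complement_entropy_itv rho01.
  case/andP: rho01 => rho0 rho1.
  have l0 : 0 <= rho * ln 2 by rewrite mulr_ge0// ltW.
  by rewrite ger0_norm ?addr_ge0// [leRHS]mulrDl mul1r [ln 2 * _]mulrC lerD2r.
Unshelve. all: by end_near. Qed.

(** Chosen so that [beta = - ln rho - lower_constant] turns the condition [rho <= expR (- beta) *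
    (expR (- 3) / 480)] into an equality. *)
Definition lower_constant : R := 3 + ln 480.

(** Where the radicand is negative, that is for [rho] not small, [Num.sqrt] makes the threshold 0
    and no [lam >= 0] lies below it. *)
Definition lower_threshold (rho : R) : R :=
  2 * Num.sqrt (- rho * ln rho + - lower_constant * rho).

Lemma lower_threshold_asymp : sqrt_rho_log_rho_asymp lower_threshold.
Proof.
have c0 : 0 < lower_constant by rewrite ltr_pwDl// ln_ge0// ler1n.
apply: (sqrt_rho_log_rho_asymp_bounded (K := lower_constant)
  (r := fun rho => - lower_constant * rho)) => //.
  by near=> rho.
move=> rho /andP[rho0 _].
by rewrite normrM normrN !gtr0_norm.
Unshelve. all: by end_near. Qed.

Lemma lower_thresholdP (rho lam : R) : 0 < rho -> 0 <= lam ->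
  lam < lower_threshold rho ->
  exists beta del, [/\ 0 < beta, rho <= expR (- beta) * (expR (- 3) / 480),
    0 < del & lam ^+ 2 + 2 * lam * del <= 4 * rho * beta].
Proof.
move=> rho0 lam0; rewrite /lower_threshold.
pose beta := - ln rho - lower_constant.
have -> : - rho * ln rho + - lower_constant * rho = rho * beta.
  by rewrite /beta; ring.
move=> lamlt.
have rb0 : 0 < rho * beta.
  rewrite ltNge; apply/negP => rb.
  by move: lamlt; rewrite ler0_sqrtr// mulr0 ltNge lam0.
have b0 : 0 < beta by rewrite -(pmulr_rgt0 _ rho0).
have l2 : lam ^+ 2 < 4 * rho * beta.
  have -> : 4 * rho * beta = (2 * Num.sqrt (rho * beta)) ^+ 2.
    by rewrite exprMn sqr_sqrtr ?(ltW rb0)//; ring.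
  by rewrite ltr_sqr ?nnegrE// mulr_ge0.
(* With [g] the gap [4 rho beta - lam^2], this gives [2 lam del = g * lam / (lam + 1) <= g]; the
   [+ 1] keeps [del] defined at [lam = 0]. *)
exists beta, ((4 * rho * beta - lam ^+ 2) / (2 * (lam + 1))); split=> //.
- have -> : - beta = ln rho + (3 + ln 480).
    by rewrite /beta /lower_constant; ring.
  have p480 : (480 : R) \in Num.pos by rewrite posrE; lra.
  rewrite (expRD (ln rho)) (expRD 3) (lnK p480) lnK ?posrE// expRN.
  suff -> : rho * (expR 3 * 480) * ((expR 3)^-1 / 480) = rho by [].
  by field; rewrite gt_eqF// expR_gt0.
- by rewrite divr_gt0 ?subr_gt0// mulr_gt0// ltr_wpDl.
- set g := 4 * rho * beta - lam ^+ 2.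
  have g0 : 0 <= g by rewrite subr_ge0 ltW.
  have -> : 4 * rho * beta = lam ^+ 2 + g by rewrite /g; ring.
  rewrite lerD2l (_ : 2 * lam * _ = g * (lam / (lam + 1))); last first.
    by field; rewrite gt_eqF// ltr_wpDl.
  by rewrite ler_piMr// ler_pdivrMr ?ltr_wpDl// mul1r lerDl.
Qed.

End asymptotics.

Theorem theorem1p6 (R : realType) (d : nat) (hd : (2 <= d)%N) :
  exists lamstar : R -> R,
    [/\ sqrt_rho_log_rho_asymp lamstar,
        sqrt_rho_log_rho_asymp
          (fun rho : R => 2 * Num.sqrt (entropy rho + rho * ln 2)) &
        forall rho : R, 0 < rho <= 1 -> sprade_dim rho !=set0 ->
        forall lam : R, 0 <= lam ->
          (lam < lamstar rho ->
             ~ strong_detection (sprade_oo rho) d lam (sprade rho) /\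
             ((3 <= d)%N ->
                ~ weak_detection (sprade_oo rho) d lam (sprade rho) /\
                ~ weak_recovery (sprade_oo rho) d lam (sprade rho))) /\
          (2 * Num.sqrt (entropy rho + rho * ln 2) < lam ->
             strong_detection (sprade_oo rho) d lam (sprade rho) /\
             weak_recovery (sprade_oo rho) d lam (sprade rho))].
Proof.
exists (@lower_threshold R); split.
- exact: lower_threshold_asymp.
- exact: upper_threshold_asymp.
move=> rho /andP[rho0 rho1] dim0 lam lam0; split.
- move=> /(lower_thresholdP rho0 lam0)[beta [del [b0 rb del0 lam_lt]]]; split.
    exact: (strong_detection_impossible b0 rho0 rho1 rb lam0 del0 lam_lt hd dim0).
  move=> d3; split.
    exact: (weak_detection_impossible b0 rho0 rho1 rb lam0 del0 lam_lt hd dim0 d3).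
  exact: (weak_recovery_impossible b0 rho0 rho1 rb lam0 del0 lam_lt hd dim0 d3).
set H := entropy rho + rho * ln 2; set h := 2 * Num.sqrt H => hlam.
have h0 : 0 <= h by rewrite mulr_ge0// sqrtr_ge0.
(* The two levels cut the interval from [h] to [lam] into equal thirds. *)
pose noise := (2 * h + lam) / 3; pose thr := (h + 2 * lam) / 3.
have noise0 : 0 <= noise by rewrite /noise; lra.
have nt : noise < thr by rewrite /noise /thr; lra.
have tl : thr < lam by rewrite /thr; lra.
have Hn : H < noise ^+ 2 / 4.
  apply: (@le_lt_trans _ _ (h ^+ 2 / 4)).
    rewrite /h exprMn (_ : 2 ^+ 2 * _ / 4 = Num.sqrt H ^+ 2); last by field.
    have [H0|/ltW H0] := leP 0 H; first by rewrite sqr_sqrtr.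
    by apply: le_trans H0 _; exact: sqr_ge0.
  rewrite ltr_pM2r ?invr_gt0// ltr_sqr ?nnegrE//.
  by rewrite /noise; lra.
split.
- exact: (strong_detection_possible d rho0 rho1 noise0 Hn nt tl).
- exact: (weak_recovery_possible d rho0 rho1 noise0 Hn nt tl).
Qed.
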